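(* Let $(\varphi,\psi)$ be a pair of kernels with $M_0(\psi)<+\infty$. For every $f\in L\log L$ and for every $\lambda>0$, $$\lim_{w\to+\infty}\int_{\mathbb{R}}\left|S_w^{\varphi,\psi}f(x)-f(x)\right|\log\left(e+\lambda\left|S_w^{\varphi,\psi}f(x)-f(x)\right|\right)dx=0,$$ or, equivalently, $$\lim_{w\to+\infty}\lVert S_w^{\varphi,\psi}f-f\rVert_{L\log L}=0.$$
   Context: For $g:\mathbb{R}\to\mathbb{R}$ and $\nu\ge 0$ put $$M_\nu(g):=\sup_{u\in\mathbb{R}}\sum_{k\in\mathbb{Z}}|g(u-k)|\,|u-k|^\nu,$$ so that $M_0(g)=\sup_{u}\sum_{k}|g(u-k)|$. A pair of kernels $(\varphi,\psi)$ is a pair of functions $\varphi,\psi:\mathbb{R}\to\mathbb{R}$ in $L^1(\mathbb{R})$ such that: $\varphi$ is bounded in a neighborhood of the origin; $\sum_{k\in\mathbb{Z}}\varphi(u-k)=1$ for every $u\in\mathbb{R}$; $\int_{\mathbb{R}}\psi(u)\,du=1$; and there exists $r>0$ with $M_r(\varphi)<+\infty$. The Durrmeyer sampling operators are, for $w>0$ and any $f$ for which the series converges for every $x$, $$(S_w^{\varphi,\psi}f)(x)=\sum_{k\in\mathbb{Z}}\varphi(wx-k)\,w\int_{\mathbb{R}}\psi(wu-k)f(u)\,du,\qquad x\in\mathbb{R}.$$ Let $\eta_{1,1}(u)=u\log(e+u)$ for $u\ge0$, and for Lebesgue measurable $f:\mathbb{R}\to\mathbb{R}$ put $I^{\eta_{1,1}}[f]:=\int_{\mathbb{R}}\eta_{1,1}(|f(x)|)\,dx$.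 The space $L\log L$ is the set of measurable $f:\mathbb{R}\to\mathbb{R}$ with $I^{\eta_{1,1}}[\lambda f]<+\infty$ for some $\lambda>0$, and $\lVert f\rVert_{L\log L}:=\inf\{\lambda>0: I^{\eta_{1,1}}[f/\lambda]\le1\}$ is its Luxemburg norm. *)

(* Defs.v *)
From HB Require Import structures.
From mathcomp Require Import all_boot all_order all_algebra.
From mathcomp Require Import all_classical all_reals all_analysis.

Set Implicit Arguments.
Unset Strict Implicit.
Unset Printing Implicit Defensive.

Import Order.TTheory GRing.Theory Num.Theory.
Import numFieldNormedType.Exports.

Local Open Scope classical_set_scope.
Local Open Scope ring_scope.

                                                                               
                                                                               
                                                                              
                                                                      
Definition lebesgueT (R : realType) :=
  caratheodory_type ((wlength (@idfun R))^*)%mu.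

Definition lebesgue_measurable (R : realType) (f : R -> R) : Prop :=
  measurable_fun [set: lebesgueT R] (f : lebesgueT R -> R).

Definition L1 (R : realType) (f : R -> R) : Prop :=
  (@completed_lebesgue_measure R).-integrable [set: lebesgueT R]
    (fun x => (f x)%:E).

                                   
Definition lebesgue_int (R : realType) (f : R -> R) : R :=
  (\int[@completed_lebesgue_measure R]_x f x)%R.

                                                                            
Definition lebesgue_eint (R : realType) (f : R -> R) : \bar R :=
  (\int[@completed_lebesgue_measure R]_x (f x)%:E)%E.

                                                                      
                                                                           
                                                                           
Definition zcvg (R : realType) (a : int -> R) : Prop :=
  cvgn (series (fun n => a (Posz n))) /\ cvgn (series (fun n => a (Negz n))).

Definition zsum (R : realType) (a : int -> R) : R :=
  limn (series (fun n => a (Posz n))) + limn (series (fun n => a (Negz n))).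

                                                                           
                                 
Definition Mabs (R : realType) (nu : R) (g : R -> R) : \bar R :=
  ereal_sup (range (fun u : R =>
    \esum_(k in [set: int]) (`|g (u - k%:~R)| * `|u - k%:~R| `^ nu)%:E)).

Definition kernel_pair (R : realType) (phi psi : R -> R) : Prop :=
  [/\ L1 phi /\ L1 psi,
      bounded_near phi (nbhs (0 : R)),
      (forall u : R, zcvg (fun k => phi (u - k%:~R)) /\
                     zsum (fun k => phi (u - k%:~R)) = 1),
      lebesgue_int psi = 1
    & exists2 r : R, 0 < r & (Mabs r phi < +oo)%E].

Definition durrmeyer_term (R : realType) (phi psi : R -> R) (w : R)
    (f : R -> R) (x : R) (k : int) : R :=
  phi (w * x - k%:~R) *
    (w * lebesgue_int (fun u => psi (w * u - k%:~R) * f u)).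

Definition durrmeyer_defined (R : realType) (phi psi : R -> R) (w : R)
    (f : R -> R) : Prop :=
  (forall k : int, L1 (fun u => psi (w * u - k%:~R) * f u)) /\
  (forall x : R, zcvg (durrmeyer_term phi psi w f x)).

Definition durrmeyer (R : realType) (phi psi : R -> R) (w : R)
    (f : R -> R) (x : R) : R :=
  zsum (durrmeyer_term phi psi w f x).

Definition eta11 (R : realType) (u : R) : R := u * ln (expR 1 + u).

Definition modular11 (R : realType) (f : R -> R) : \bar R :=
  lebesgue_eint (fun x => eta11 `|f x|).

Definition LlogL (R : realType) (f : R -> R) : Prop :=
  lebesgue_measurable f /\
  exists2 lambda : R, 0 < lambda &
    (modular11 (fun x => lambda * f x)%R < +oo)%E.

                                                                            
                            
Definition LlogL_norm (R : realType) (f : R -> R) : \bar R :=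
  ereal_inf [set lambda%:E | lambda in
    [set lambda : R | 0 < lambda /\
      (modular11 (fun x => f x / lambda)%R <= 1)%E]].

(* Main.v *)
Require Import Defs.
From mathcomp Require Import all_boot all_order all_algebra.
From mathcomp Require Import all_classical all_reals all_analysis.
From mathcomp Require Import measurable_realfun simple_functions.
From mathcomp Require Import ring lra zify.

Import Order.TTheory GRing.Theory Num.Theory.
Import numFieldNormedType.Exports.
Import HBSimple.

(** The proof combines a modular inequality that is uniform in [w] with
    convergence in L1.

    Let [h] be convex, nondecreasing and vanishing at the origin. The Durrmeyer
    series is dominated by a sum with weights [|phi (w x - k)|] of integrals with
    weights [w |psi (w u - k)|]; both families of weights have bounded mass,
    because [M_0 phi] and the L1 norm of [psi] are finite. Applying Jensen's
    inequality to each and integrating in [x] bounds the integral of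
    [h |S_w f|] by a constant times the integral of [h (c |f|)]; the summation
    over [k] uses [M_0 psi < +oo] ([modular_durrmeyer]). For [h] the identity this
    says that the operators are bounded on L1 uniformly in [w]; for
    [h u = u ln (e + u)] it is a modular bound in L log L, where constants such
    as [c] are harmless by the Delta_2 condition ([eta11_scale]). That
    [M_0 phi] is finite follows from the finiteness of one moment of [phi] and
    its boundedness near the origin ([Mabs_bounded_near]).

    Convergence in L1 ([durrmeyer_L1_cvg]) then only has to be checked on a dense
    class. Since [phi] is a partition of unity and [psi] has integral one, the
    error of [S_w f] is at most the sum, over [kappa = phi, psi], of constants
    times the integral of [|kappa t|] against
    [1/w * sum_k |f ((t + k) / w) - f (k / w)|] ([durrmeyer_L1_error]). For the
    indicator of a finite union of intervals this last sum counts integers that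
    cross an end point when they are translated by [t]; it is bounded by a
    constant times [min (w, |t| + 1)], and dominated convergence applies. These
    indicators span a dense subspace of L1 because Lebesgue measure is
    defined by covers with intervals ([tame_approx_indic]).

    Finally, split [f] in L log L into a bounded truncation [g] and a remainder
    [r] of small modular. The modular inequality makes [S_w r] small as well,
    uniformly in [w]. The function [S_w g - g] is bounded uniformly in [w], and
    on bounded sets [u ln (e + lambda u)] is at most a multiple of [u], so that
    the L1 convergence of [S_w g] concludes ([durrmeyer_eta_cvg]). The Luxemburg
    norm tends to zero because the modular does so at every scale.

    Measurability is Lebesgue measurability throughout, so all integrals are
    taken directly over the Caratheodory sigma-algebra; its compatibility with
    affine maps is [integral_aff]. *)

Local Open Scope classical_set_scope.
Local Open Scope ring_scope.

Set Implicit Arguments.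
Unset Strict Implicit.
Unset Printing Implicit Defensive.

(** * Affine changes of variable for the completed Lebesgue measure *)
Section affine.
Context {R : realType}.
Local Notation T := (lebesgueT R).
Local Notation mu := (@completed_lebesgue_measure R).
Local Notation nu := ((wlength (@idfun R))^*)%mu.

Definition aff (w b : R) : T -> T := fun u => w * u - b.

Lemma affK (w b : R) : 0 < w -> cancel (aff w b) (aff w^-1 (- (b / w))).
Proof. by move=> w0 u; rewrite /aff; field; rewrite gt_eqF. Qed.

Lemma affVK (w b : R) : 0 < w -> cancel (aff w^-1 (- (b / w))) (aff w b).
Proof. by move=> w0 u; rewrite /aff; field; rewrite gt_eqF. Qed.

Lemma wlength_aff (w b : R) (A : set R) : 0 < w -> ocitv A ->
  ocitv (aff w b @^-1` A) /\
  (wlength idfun A = w%:E * wlength idfun (aff w b @^-1` A))%E.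
Proof.
move=> w0 [[x y] _ <-] /=.
have -> : aff w b @^-1` `]x, y]%classic = `](x + b) / w, (y + b) / w]%classic.
  by apply/seteqP; split=> u; rewrite /aff /= !in_itv /=;
    rewrite ltr_pdivrMr// ler_pdivlMr// ltrBrDr lerBlDr mulrC.
split; first by exists ((x + b) / w, (y + b) / w).
rewrite !wlength_itv /= !lte_fin ltr_pM2r ?invr_gt0// ltrD2r.
case: ifP => xy; last by rewrite mule0.
rewrite -!EFinB -EFinM; congr (_%:E); field; exact: lt0r_neq0.
Qed.

(** An interval cover of a set pulls back to an interval cover of its preimage,
    with all lengths divided by [w]; applying this to the inverse map as well
    turns the inequality into [outer_aff]. Working with the outer measure gives
    the scaling for every set, so that the measurability of affine maps can be
    read off the Caratheodory criterion. *)
Lemma outer_aff_le (w b : R) (A : set R) : 0 < w ->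
  (w%:E * nu (aff w b @^-1` A) <= nu A)%E.
Proof.
move=> w0; apply/le_ereal_inf_tmp => _ [F [mF AF] <-].
have H n := wlength_aff b w0 (mF n).
under eq_eseriesr do rewrite (H _).2.
rewrite nneseriesZl; last by move=> n _; apply: wlength_ge0.
rewrite lee_pmul2l//; apply: ereal_inf_lbound => /=.
exists (fun n => aff w b @^-1` F n) => //; split=> [n|]; first exact: (H n).1.
by move=> u /= /AF [n _ Fn]; exists n.
Qed.

Lemma outer_aff (w b : R) (A : set R) : 0 < w ->
  (nu (aff w b @^-1` A) = w^-1%:E * nu A)%E.
Proof.
move=> w0; apply/eqP; rewrite eq_le; apply/andP; split.
  rewrite -(@lee_pmul2l _ w%:E)// muleA -EFinM divff ?gt_eqF// mul1e.
  exact: outer_aff_le.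
have wi0 : 0 < w^-1 by rewrite invr_gt0.
have := outer_aff_le (- (b / w)) (aff w b @^-1` A) wi0.
rewrite (_ : aff _ _ @^-1` _ = A)//.
by apply/seteqP; split=> u /=; rewrite affVK.
Qed.

(** The Caratheodory criterion for the preimage of [A] at a test set [X] is the
    criterion for [A] at the image of [X], divided by [w]. *)
Lemma aff_measurable (w b : R) : 0 < w -> measurable_fun [set: T] (aff w b).
Proof.
move=> w0 _ A mA; rewrite setTI.
have cA X : (nu X = nu (X `&` A) + nu (X `&` ~` A))%E := mA X.
suff cP X : (nu X = nu (X `&` aff w b @^-1` A) +
                    nu (X `&` ~` (aff w b @^-1` A)))%E by exact: cP.
have -> : X = aff w b @^-1` (aff w^-1 (- (b / w)) @^-1` X).
  by apply/seteqP; split=> u /=; rewrite affK.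
set Y := _ @^-1` X.
transitivity (w^-1%:E * nu Y)%E; first exact: outer_aff.
rewrite (cA Y) ge0_muleDr ?outer_measure_ge0//; congr (_ + _)%E; symmetry.
  exact: (outer_aff b (Y `&` A)).
exact: (outer_aff b (Y `&` ~` A)).
Qed.

Lemma integral_aff (w b : R) (g : T -> \bar R) : 0 < w ->
  measurable_fun [set: T] g -> (forall x, 0 <= g x)%E ->
  (\int[mu]_x g (aff w b x) = w^-1%:E * \int[mu]_x g x)%E.
Proof.
move=> w0 mg g0; have wi0 : 0 <= w^-1 by rewrite invr_ge0 ltW.
have := @ge0_integral_pushforward _ _ T T R _ (aff_measurable b w0) mu _ g
  measurableT mg (fun y _ => g0 y).
rewrite preimage_setT => <-.
rewrite -(@ge0_integral_mscale _ T R mu _ measurableT (NngNum wi0)) //.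
apply: eq_measure_integral => [|mf A _ _]; first exact: aff_measurable.
exact: (outer_aff b A w0).
Qed.

End affine.

(** * Series indexed by the integers *)
Section zser.
Context {R : realType}.
Local Notation T := (lebesgueT R).
Local Notation mu := (@completed_lebesgue_measure R).
Local Open Scope ereal_scope.
Implicit Types a b : int -> \bar R.

(** The non-negative terms and the negative ones are summed together, which
    makes this a single series and matches the two halves of [zsum]. *)
Definition zser a : \bar R := \sum_(0 <= n <oo) (a (Posz n) + a (Negz n)).

Lemma zser_ge0 a : (forall k, 0 <= a k) -> 0 <= zser a.
Proof. by move=> a0; apply: nneseries_ge0 => n _ _; rewrite adde_ge0. Qed.

Lemma le_zser a b : (forall k, 0 <= a k) -> (forall k, a k <= b k) ->
  zser a <= zser b.
Proof.
move=> a0 ab; apply: lee_nneseries => n _; first by move=> *; rewrite adde_ge0.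
by rewrite leeD.
Qed.

Lemma eq_zser a b : (forall k, a k = b k) -> zser a = zser b.
Proof. by move=> /funext ->. Qed.

Lemma zserZ (c : R) a : (0 <= c)%R -> (forall k, 0 <= a k) ->
  zser (fun k => c%:E * a k) = c%:E * zser a.
Proof.
move=> c0 a0; rewrite -nneseriesZl; last by move=> *; rewrite adde_ge0.
by apply: eq_eseriesr => n _; rewrite ge0_muleDr.
Qed.

Lemma zserD a b : (forall k, 0 <= a k) -> (forall k, 0 <= b k) ->
  zser (fun k => a k + b k) = zser a + zser b.
Proof.
move=> a0 b0; rewrite -nneseriesD; try by move=> *; rewrite adde_ge0.
by apply: eq_eseriesr => n _; rewrite addeACA.
Qed.

Lemma zserE a : (forall k, 0 <= a k) -> \esum_(k in [set: int]) a k = zser a.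
Proof.
move=> a0; rewrite (esumID (range Posz))// setTI (_ : _ `&` _ = range Negz); last first.
  apply/seteqP; split=> [[n|n] /= [_ //]|_ [n _ <-]].
  - by move=> H; exfalso; apply: H; exists n.
  - by move=> _; exists n.
  - by split=> // -[].
rewrite !esum_image//; try by move=> ? ? _ _ [].
rewrite -!nneseries_esumT; try by move=> n; exact: a0.
by rewrite -nneseriesD.
Qed.

Lemma measurable_zser (f : int -> T -> \bar R) :
  (forall k, measurable_fun [set: T] (f k)) -> (forall k x, 0 <= f k x) ->
  measurable_fun [set: T] (fun x => zser (f ^~ x)).
Proof.
move=> mf f0; apply: ge0_emeasurable_sum => [n x _ _|n _].
  by rewrite adde_ge0.
exact: emeasurable_funD.
Qed.

Lemma integral_zser (f : int -> T -> \bar R) :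
  (forall k, measurable_fun [set: T] (f k)) -> (forall k x, 0 <= f k x) ->
  \int[mu]_x zser (f ^~ x) = zser (fun k => \int[mu]_x f k x).
Proof.
move=> mf f0.
transitivity (\sum_(n <oo)
    \int[mu]_x ((fun n x => f (Posz n) x + f (Negz n) x) n x)).
  apply: (@integral_nneseries _ T R mu _ measurableT) => [n|n x _].
    exact: emeasurable_funD.
  by rewrite adde_ge0.
by apply: eq_eseriesr => n _; rewrite (@ge0_integralD _ T R mu _ measurableT).
Qed.

End zser.

Section zsum.
Context {R : realType}.
Implicit Types a b : int -> R.

Definition abs_zcvg a : Prop := (zser (fun k => `|a k|%:E) < +oo)%E.

Lemma nneseries_fin_cvg (u : nat -> R) :
  (\sum_(0 <= n <oo) `|u n|%:E < +oo)%E -> cvgn (series (fun n => `|u n|)).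
Proof.
move=> H; apply: nondecreasing_is_cvgn.
  by apply: nondecreasing_series => n _ _.
exists (fine (\sum_(0 <= n <oo) `|u n|%:E)%E) => _ [n _ <-].
rewrite -lee_fin fineK; last first.
  by rewrite ge0_fin_numE// nneseries_ge0// => k _ _; rewrite lee_fin.
rewrite /series /= -sumEFin.
by apply: nneseries_lim_ge => k _ _; rewrite lee_fin.
Qed.

Lemma nneseries_EFin (u : nat -> R) : cvgn (series (fun n => `|u n|)) ->
  (\sum_(0 <= n <oo) `|u n|%:E)%E = (limn (series (fun n => `|u n|)))%:E.
Proof.
move=> cu; apply/cvg_lim => //.
under eq_fun do rewrite sumEFin.
by apply: cvg_EFin; [exact: nearW|exact: cu].
Qed.

Lemma zabs_split a : abs_zcvg a ->
  (\sum_(0 <= n <oo) `|a (Posz n)|%:E < +oo)%E /\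
  (\sum_(0 <= n <oo) `|a (Negz n)|%:E < +oo)%E.
Proof.
rewrite /abs_zcvg /zser nneseriesD; try by move=> *; rewrite lee_fin.
move=> H; split; apply: le_lt_trans H; rewrite (leeDl, leeDr)//;
  by apply: nneseries_ge0 => n _ _; rewrite lee_fin.
Qed.

Lemma zabs_zcvg a : abs_zcvg a -> zcvg a.
Proof.
by case/zabs_split=> /nneseries_fin_cvg ? /nneseries_fin_cvg ?; split;
  exact: normed_cvg.
Qed.

Lemma zsum_le a : (`|zsum a|%:E <= zser (fun k => `|a k|%:E))%E.
Proof.
have [aoo|] := leP +oo%E (zser (fun k => `|a k|%:E))%E.
  exact: le_trans (leey _) aoo.
case/zabs_split=> /nneseries_fin_cvg c1 /nneseries_fin_cvg c2.
rewrite /zser nneseriesD; try by move=> *; rewrite lee_fin.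
rewrite !nneseries_EFin// -EFinD lee_fin /zsum.
by rewrite (le_trans (ler_normD _ _))// lerD// lim_series_norm.
Qed.

Lemma zsumD a b : zcvg a -> zcvg b ->
  zsum (fun k => a k + b k) = zsum a + zsum b.
Proof.
move=> [a1 a2] [b1 b2]; rewrite /zsum addrACA; congr (_ + _).
  by rewrite -lim_seriesD.
by rewrite -lim_seriesD.
Qed.

Lemma zsumZ (c : R) a : zcvg a -> zsum (fun k => a k * c) = zsum a * c.
Proof.
move=> [a1 a2]; rewrite /zsum mulrDl !(mulrC _ c).
rewrite -[c * _]/(c *: _) -[c * limn (series (fun n => a (Negz n)))]/(c *: _).
by rewrite -!lim_seriesZ//; congr (limn (series _) + limn (series _));
  apply/funext => n /=; rewrite mulrC.
Qed.

Lemma zcvgZ (c : R) a : zcvg a -> zcvg (fun k => a k * c).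
Proof.
move=> [a1 a2]; split.
  rewrite (_ : (fun n => _) = c *: (fun n => a (Posz n))).
    exact: is_cvg_seriesZ.
  by apply/funext => n /=; rewrite mulrC.
rewrite (_ : (fun n => _) = c *: (fun n => a (Negz n))).
  exact: is_cvg_seriesZ.
by apply/funext => n /=; rewrite mulrC.
Qed.

Lemma measurable_zsum (f : int -> lebesgueT R -> R) :
  (forall k, measurable_fun [set: lebesgueT R] (f k)) ->
  (forall x, zcvg (f ^~ x)) ->
  measurable_fun [set: lebesgueT R] (fun x => zsum (f ^~ x)).
Proof.
move=> mf cf; apply: measurable_funD.
  apply: (measurable_fun_cvg (h := fun n x => series (fun n => f (Posz n) x) n)).
    by move=> n; exact: measurable_sum.
  by move=> x _; exact: (cf x).1.
apply: (measurable_fun_cvg (h := fun n x => series (fun n => f (Negz n) x) n)).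
  by move=> n; exact: measurable_sum.
by move=> x _; exact: (cf x).2.
Qed.

End zsum.

(** * Lebesgue measurable functions and their integrals *)
Section lint.
Context {R : realType}.
Local Notation T := (lebesgueT R).
Local Notation mu := (@completed_lebesgue_measure R).

Lemma lebesgue_measurable_id : lebesgue_measurable (fun x : R => x).
Proof. by move=> _ A mA; rewrite setTI; exact: sub_caratheodory. Qed.

Lemma lebesgue_measurable_comp (h f : R -> R) : measurable_fun [set: R] h ->
  lebesgue_measurable f -> lebesgue_measurable (fun x => h (f x)).
Proof. by move=> mh mf; exact: (@measurableT_comp _ _ _ T _ _ h setT f mh mf). Qed.

Lemma lebesgue_measurable_cst (c : R) : lebesgue_measurable (fun=> c).
Proof. exact: measurable_cst. Qed.

Lemma lebesgue_measurable_norm (f : R -> R) :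
  lebesgue_measurable f -> lebesgue_measurable (fun x => `|f x|).
Proof. by apply: lebesgue_measurable_comp; exact: normr_measurable. Qed.

Lemma lebesgue_measurableD (f g : R -> R) : lebesgue_measurable f ->
  lebesgue_measurable g -> lebesgue_measurable (fun x => f x + g x).
Proof. by move=> mf mg; exact: (@measurable_funD _ T R setT f g mf mg). Qed.

Lemma lebesgue_measurableM (f g : R -> R) : lebesgue_measurable f ->
  lebesgue_measurable g -> lebesgue_measurable (fun x => f x * g x).
Proof. by move=> mf mg; exact: (@measurable_funM _ T R setT f g mf mg). Qed.

Lemma lebesgue_measurableB (f g : R -> R) : lebesgue_measurable f ->
  lebesgue_measurable g -> lebesgue_measurable (fun x => f x - g x).
Proof. by move=> mf mg; exact: (@measurable_funB _ T R setT f g mf mg). Qed.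

Lemma lebesgue_measurable_aff (f : R -> R) (w b : R) : 0 < w ->
  lebesgue_measurable f -> lebesgue_measurable (fun x => f (w * x - b)).
Proof.
move=> w0 mf.
exact: (@measurableT_comp _ _ _ T T _ f setT (aff w b) mf (aff_measurable b w0)).
Qed.

(** [lmeas] and [lint] fix the completed Lebesgue structure once and for all:
    functions on the reals can then be measured and integrated without their
    domain being cast. *)
Definition lmeas (g : R -> \bar R) := measurable_fun [set: T] (g : T -> \bar R).

Lemma lmeas_EFin (f : R -> R) :
  lebesgue_measurable f -> lmeas (fun x => (f x)%:E).
Proof. by move=> mf; apply/(@measurable_EFinP _ T R setT f). Qed.

Definition lint (g : R -> \bar R) : \bar R :=
  (\int[mu]_x (g : T -> \bar R) x)%E.

Lemma lebesgue_eintE (f : R -> R) : lebesgue_eint f = lint (fun x => (f x)%:E).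
Proof. by []. Qed.

Lemma lint_ge0 (g : R -> \bar R) : (forall x, 0 <= g x)%E -> (0 <= lint g)%E.
Proof. by move=> g0; apply: integral_ge0. Qed.

Lemma eq_lint (g h : R -> \bar R) : g =1 h -> lint g = lint h.
Proof. by move=> /funext ->. Qed.

Lemma le_lint (g h : R -> \bar R) : lmeas g -> lmeas h ->
  (forall x, 0 <= g x)%E -> (forall x, g x <= h x)%E -> (lint g <= lint h)%E.
Proof.
move=> mg mh g0 gh.
exact: (@ge0_le_integral _ T R mu setT measurableT g h
  (fun x _ => g0 x) mg mh (fun x _ => gh x)).
Qed.

Lemma lintZ (c : R) (g : R -> \bar R) : 0 <= c -> lmeas g ->
  (forall x, 0 <= g x)%E -> lint (fun x => c%:E * g x)%E = (c%:E * lint g)%E.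
Proof.
move=> c0 mg g0.
exact: (@ge0_integralZl_EFin _ T R mu setT measurableT g (fun x _ => g0 x) mg
  c c0).
Qed.

Lemma lintD (g h : R -> \bar R) : lmeas g -> lmeas h ->
  (forall x, 0 <= g x)%E -> (forall x, 0 <= h x)%E ->
  lint (fun x => g x + h x)%E = (lint g + lint h)%E.
Proof.
move=> mg mh g0 h0.
exact: (@ge0_integralD _ T R mu setT measurableT g h (fun x _ => g0 x) mg
  (fun x _ => h0 x) mh).
Qed.

Lemma lmeas_zser (g : int -> R -> \bar R) : (forall k, lmeas (g k)) ->
  (forall k x, 0 <= g k x)%E -> lmeas (fun x => zser (g ^~ x)).
Proof. by move=> mg g0; exact: (@measurable_zser R g mg g0). Qed.

Lemma lint_zser (g : int -> R -> \bar R) : (forall k, lmeas (g k)) ->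
  (forall k x, 0 <= g k x)%E ->
  lint (fun x => zser (g ^~ x)) = zser (fun k => lint (g k)).
Proof. by move=> mg g0; exact: (@integral_zser R g mg g0). Qed.

Lemma lint_aff (w b : R) (g : R -> \bar R) : 0 < w -> lmeas g ->
  (forall x, 0 <= g x)%E ->
  lint (fun x => g (w * x - b)) = (w^-1%:E * lint g)%E.
Proof. by move=> w0 mg g0; exact: (@integral_aff R w b g w0 mg g0). Qed.

Lemma L1P (f : R -> R) : L1 f <->
  lebesgue_measurable f /\ (lint (fun x => `|f x|%:E) < +oo)%E.
Proof.
split=> [/integrableP[/measurable_EFinP mf foo]//|[mf foo]].
by apply/integrableP; split; [exact: lmeas_EFin|exact: foo].
Qed.

Lemma L1_meas (f : R -> R) : L1 f -> lebesgue_measurable f.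
Proof. by case/L1P. Qed.

Lemma L1_dom (f g : R -> R) : lebesgue_measurable f ->
  (forall x, `|f x| <= `|g x|) -> L1 g -> L1 f.
Proof.
move=> mf fg /L1P[mg goo]; apply/L1P; split=> //; apply: le_lt_trans goo.
apply: le_lint => [||x|x]; try exact/lmeas_EFin/lebesgue_measurable_norm.
- by rewrite lee_fin.
- by rewrite lee_fin.
Qed.

Lemma L1Z (c : R) (f : R -> R) : L1 f -> L1 (fun x => c * f x).
Proof. exact: (@integrableZl _ T R mu setT measurableT c (EFin \o f)). Qed.

Lemma L1D (f g : R -> R) : L1 f -> L1 g -> L1 (fun x => f x + g x).
Proof.
exact: (@integrableD _ T R mu setT measurableT (EFin \o f) (EFin \o g)).
Qed.

Lemma L1B (f g : R -> R) : L1 f -> L1 g -> L1 (fun x => f x - g x).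
Proof.
exact: (@integrableB _ T R mu setT measurableT (EFin \o f) (EFin \o g)).
Qed.

Lemma L1_norm (f : R -> R) : L1 f -> L1 (fun x => `|f x|).
Proof.
by move=> f1; apply: (L1_dom _ _ f1) => [|x]; rewrite ?normr_id//;
  exact/lebesgue_measurable_norm/L1_meas.
Qed.

Lemma lebesgue_int_le (f : R -> R) : L1 f ->
  (`|lebesgue_int f|%:E <= lint (fun x => `|f x|%:E))%E.
Proof.
move=> f1; rewrite (@EFin_normr_Rintegral _ T R mu setT f measurableT f1).
exact: (@le_abse_integral _ T R mu setT (EFin \o f) measurableT
  (lmeas_EFin (L1_meas f1))).
Qed.

Lemma lebesgue_intZ (c : R) (f : R -> R) : L1 f ->
  lebesgue_int (fun x => c * f x) = c * lebesgue_int f.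
Proof. exact: (@RintegralZl _ T R mu setT f c measurableT). Qed.

Lemma lebesgue_intD (f g : R -> R) : L1 f -> L1 g ->
  lebesgue_int (fun x => f x + g x) = lebesgue_int f + lebesgue_int g.
Proof. exact: (@RintegralD _ T R mu setT f g measurableT). Qed.

Lemma lebesgue_intB (f g : R -> R) : L1 f -> L1 g ->
  lebesgue_int (fun x => f x - g x) = lebesgue_int f - lebesgue_int g.
Proof. exact: (@RintegralB _ T R mu setT f g measurableT). Qed.

Lemma L1_aff (w b : R) (f : R -> R) : 0 < w -> L1 f ->
  L1 (fun x => f (w * x - b)).
Proof.
move=> w0 /L1P[mf foo]; apply/L1P; split; first exact: lebesgue_measurable_aff.
rewrite (@lint_aff w b (fun x => `|f x|%:E))//; last first.
  exact/lmeas_EFin/lebesgue_measurable_norm.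
by apply: lte_mul_pinfty => //; rewrite lee_fin invr_ge0 ltW.
Qed.

Lemma lint_fin (f : R -> R) : L1 f -> (forall x, 0 <= f x) ->
  lint (fun x => (f x)%:E) = (lebesgue_int f)%:E.
Proof.
move=> f1 f0; rewrite /lebesgue_int /Rintegral fineK//.
by apply: integrable_fin_num.
Qed.

(** The change of variable is known for non-negative functions; a signed
    integrable one is the difference of its positive and negative parts. *)
Lemma lebesgue_int_aff (w b : R) (f : R -> R) : 0 < w -> L1 f ->
  lebesgue_int (fun x => f (w * x - b)) = w^-1 * lebesgue_int f.
Proof.
move=> w0 f1; pose p x := (`|f x| + f x) / 2; pose n x := (`|f x| - f x) / 2.
have fE : f = fun x => p x - n x by apply/funext => x; rewrite /p /n; field.
have p1 : L1 p.
  rewrite (_ : p = fun x => 2^-1 * (`|f x| + f x)).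
    by apply: L1Z; apply: L1D => //; exact: L1_norm.
  by apply/funext => x; rewrite /p mulrC.
have n1 : L1 n.
  rewrite (_ : n = fun x => 2^-1 * (`|f x| - f x)).
    by apply: L1Z; apply: L1B => //; exact: L1_norm.
  by apply/funext => x; rewrite /n mulrC.
have p0 x : 0 <= p x.
  by rewrite divr_ge0// -lerBlDr sub0r -normrN ler_norm.
have n0 x : 0 <= n x by rewrite divr_ge0// subr_ge0 ler_norm.
have K g : L1 g -> (forall x, 0 <= g x) ->
    lebesgue_int (fun x => g (w * x - b)) = w^-1 * lebesgue_int g.
  move=> g1 g0; apply: EFin_inj.
  rewrite -(lint_fin (L1_aff b w0 g1))// EFinM -(lint_fin g1)//.
  apply: (@lint_aff w b (fun x => (g x)%:E)) => //.
  exact/lmeas_EFin/L1_meas.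
rewrite {1}fE [in RHS]fE !lebesgue_intB//; try exact: L1_aff.
by rewrite !K// mulrBr.
Qed.

End lint.

(** * Convex gauges and the function u log(e + u) *)
Section gauge.
Context {R : realType}.
Implicit Types (h : R -> R) (m u s t : R).

(** Convexity enters Jensen's inequality only through supporting lines, so
    these are taken as the definition: [s * u - t] supports [h] at [m]. The
    condition [0 <= t] lets the inequality hold for weights whose total mass is
    less than one, and [0 <= s] makes [h] nondecreasing. *)
Definition gauge h : Prop :=
  [/\ measurable_fun [set: R] h,
      forall u, 0 <= u -> 0 <= h u
    & forall m, 0 <= m -> exists s t, [/\ 0 <= s, 0 <= t, h m = s * m - t
        & forall u, 0 <= u -> s * u <= h u + t]].

Lemma gauge_le h u m : gauge h -> 0 <= m -> m <= u -> h m <= h u.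
Proof.
move=> [_ _ hs] m0 mu; have [s [t [s0 t0 -> H]]] := hs m m0.
by rewrite lerBlDr (le_trans _ (H u (le_trans m0 mu)))// ler_wpM2l.
Qed.

Lemma gauge_id : gauge idfun.
Proof.
split; [exact: measurable_id|by []|move=> m m0]; exists 1, 0; split=> //; first by rewrite mul1r subr0.
by move=> u _; rewrite mul1r addr0.
Qed.

Lemma gauge_scale h c : 0 <= c -> gauge h -> gauge (fun u => h (c * u)).
Proof.
move=> c0 [mh h0 hs]; split.
- by apply: (measurableT_comp mh); exact: mulrl_measurable.
- by move=> u u0; apply: h0; rewrite mulr_ge0.
- move=> m m0; have [s [t [s0 t0 hE H]]] := hs (c * m) (mulr_ge0 c0 m0).
  exists (s * c), t; split=> //; first exact: mulr_ge0.
    by rewrite hE mulrA.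
  by move=> u u0; rewrite -mulrA; apply: H; rewrite mulr_ge0.
Qed.

Lemma e_gt0 u : 0 <= u -> 0 < expR 1 + u :> R.
Proof. by move=> u0; rewrite ltr_pwDl// expR_gt0. Qed.

Lemma ln_ge1 u : 0 <= u -> 1 <= ln (expR 1 + u).
Proof.
move=> u0; rewrite -[leLHS](expRK 1) ler_ln ?posrE ?expR_gt0 ?e_gt0//.
by rewrite lerDl.
Qed.

Lemma le_ln_e u v : 0 <= u -> u <= v -> ln (expR 1 + u) <= ln (expR 1 + v).
Proof.
move=> u0 uv; have v0 := le_trans u0 uv.
by rewrite ler_ln ?posrE ?e_gt0// lerD2l.
Qed.

Lemma eta11_ge u : 0 <= u -> u <= eta11 u.
Proof. by move=> u0; rewrite /eta11 ler_peMr// ln_ge1. Qed.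

Lemma eta11_ge0 u : 0 <= u -> 0 <= eta11 u.
Proof. by move=> u0; apply: le_trans (eta11_ge u0). Qed.

Lemma eta11_measurable : measurable_fun [set: R] (@eta11 R).
Proof.
apply: measurable_funM => //; apply: (measurableT_comp (@measurable_ln R)).
by apply: measurable_funD.
Qed.

(** The supporting line at [m] has the slope of the derivative,
    [ln (e + m) + m / (e + m)]. That it stays below the graph follows from
    [1 - 1/y <= ln y] at [y = (e + u) / (e + m)], after which the remainder is
    [(u - m)^2 e / ((e + u) (e + m))]. *)
Lemma gauge_eta11 : gauge (@eta11 R).
Proof.
split; [exact: eta11_measurable|exact: eta11_ge0|move=> m m0].
have em := e_gt0 m0; have lm := ln_ge1 m0.
exists (ln (expR 1 + m) + m / (expR 1 + m)), (m ^+ 2 / (expR 1 + m)); split.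
- by rewrite addr_ge0 ?divr_ge0 ?(ltW em)// (le_trans _ lm).
- by rewrite divr_ge0 ?sqr_ge0 ?(ltW em).
- by rewrite /eta11; field; rewrite gt_eqF.
- move=> u u0; have eu := e_gt0 u0; rewrite /eta11.
  have H : (u - m) / (expR 1 + u) <= ln (expR 1 + u) - ln (expR 1 + m).
    have := @le_ln1Dx R ((m - u) / (expR 1 + u)).
    rewrite (_ : 1 + _ = (expR 1 + m) / (expR 1 + u)); last first.
      by field; rewrite gt_eqF.
    rewrite ln_div ?posrE// (_ : (u - m) / _ = - ((m - u) / (expR 1 + u))).
      move=> K; rewrite lerNl opprB; apply: K.
      by rewrite ltr_pdivlMr//; lra.
    by rewrite -mulNr opprB.
  have {}H := ler_wpM2l u0 H.
  (* The gap between the graph and the line is at least this quantity. *)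
  have K : 0 <= u * ((u - m) / (expR 1 + u)) - m * (u - m) / (expR 1 + m).
    rewrite (_ : _ - _ =
      (u - m) ^+ 2 * expR 1 / ((expR 1 + u) * (expR 1 + m))).
      by apply: divr_ge0; apply: mulr_ge0; rewrite ?sqr_ge0 ?expR_ge0 ?ltW.
    by field; rewrite !gt_eqF.
  rewrite -subr_ge0; have -> : u * ln (expR 1 + u) + m ^+ 2 / (expR 1 + m) -
     (ln (expR 1 + m) + m / (expR 1 + m)) * u =
     u * (ln (expR 1 + u) - ln (expR 1 + m)) - m * (u - m) / (expR 1 + m).
    by field; rewrite gt_eqF.
  by apply: le_trans K _; rewrite lerD2r.
Qed.

(** This is the Delta_2 condition, from [ln (d (e + u)) <= (1 + ln d) ln (e + u)]
    for [d >= 1]. It makes multiplicative constants inside the modular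
    harmless. *)
Lemma eta11_scale c : 0 <= c -> exists2 K : R, 0 < K &
  forall u, 0 <= u -> eta11 (c * u) <= K * eta11 u.
Proof.
move=> c0; pose d := Num.max c 1.
have d1 : 1 <= d by rewrite le_max lexx orbT.
have d0 : 0 < d by apply: lt_le_trans d1.
exists (d * (1 + ln d)).
  by rewrite mulr_gt0// ltr_pwDl// ln_ge0.
move=> u u0; apply: (@le_trans _ _ (eta11 (d * u))).
  by apply: (gauge_le gauge_eta11); rewrite ?mulr_ge0// ler_wpM2r// le_max lexx.
rewrite /eta11 (_ : d * (1 + ln d) * _ = d * u * ((1 + ln d) * ln (expR 1 + u))).
  2: by ring.
rewrite ler_wpM2l ?mulr_ge0 ?(ltW d0)//.
apply: (@le_trans _ _ (ln (d * (expR 1 + u)))).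
  rewrite ler_ln ?posrE ?mulr_gt0 ?e_gt0//; last by rewrite mulr_ge0// ltW.
  by rewrite mulrDr lerD2r ler_peMl// expR_ge0.
rewrite lnM ?posrE ?e_gt0// mulrDl mul1r addrC lerD2l ler_peMr ?ln_ge0//.
exact: ln_ge1.
Qed.

(** Monotonicity is enough: a sum of three numbers is at most three times the
    largest. *)
Lemma gauge_add3 h (a b c : R) : gauge h -> 0 <= a -> 0 <= b -> 0 <= c ->
  h (a + b + c) <= h (3 * a) + h (3 * b) + h (3 * c).
Proof.
move=> gh a0 b0 c0; have [_ h0 _] := gh.
have s0 : 0 <= a + b + c by rewrite !addr_ge0.
have p x : 0 <= x -> 0 <= h (3 * x) by move=> x0; apply: h0; rewrite mulr_ge0.
have := p _ a0; have := p _ b0; have := p _ c0 => pc pb pa.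
have [ab|ba] := leP a b; have [bc|cb] := leP b c.
- by apply: (@le_trans _ _ (h (3 * c))); [apply: gauge_le => //; lra|lra].
- by apply: (@le_trans _ _ (h (3 * b))); [apply: gauge_le => //; lra|lra].
- have [ac|ca] := leP a c.
    by apply: (@le_trans _ _ (h (3 * c))); [apply: gauge_le => //; lra|lra].
  by apply: (@le_trans _ _ (h (3 * a))); [apply: gauge_le => //; lra|lra].
- by apply: (@le_trans _ _ (h (3 * a))); [apply: gauge_le => //; lra|lra].
Qed.

End gauge.

(** * Jensen's inequality for weights of mass at most one *)
Section jensen.
Context {R : realType}.
Implicit Types (h : R -> R) (m : R).

Lemma zser_term (a : int -> \bar R) k : (forall k, 0 <= a k)%E ->
  (a k <= zser a)%E.
Proof.
move=> a0; rewrite -zserE//; apply: esum_ge; exists [set k].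
  by split=> //; exact: finite_set1.
by rewrite fsbig_set1.
Qed.

(** Integrate the supporting line at [m] against the weight [a]: the constant
    term contributes at most [t], because [a] has mass at most one. *)
Lemma jensen_lint h (a u : R -> R) m : gauge h ->
  lebesgue_measurable a -> (forall x, 0 <= a x) ->
  (lint (fun x => (a x)%:E) <= 1)%E ->
  lebesgue_measurable u -> (forall x, 0 <= u x) -> 0 <= m ->
  (m%:E <= lint (fun x => (a x * u x)%:E))%E ->
  ((h m)%:E <= lint (fun x => (a x * h (u x))%:E))%E.
Proof.
move=> gh ma a0 a1 mu u0 m0 mle; have [mh h0 hs] := gh.
have [s [t [s0 t0 -> H]]] := hs m m0.
have mahu : lebesgue_measurable (fun x => a x * h (u x)).
  by apply: lebesgue_measurableM => //; exact: lebesgue_measurable_comp.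
have au0 x : (0 <= (a x * u x)%:E)%E by rewrite lee_fin mulr_ge0.
have ahu0 x : (0 <= (a x * h (u x))%:E)%E by rewrite lee_fin mulr_ge0// h0.
rewrite EFinB leeBlDr//.
apply: (@le_trans _ _ (s%:E * lint (fun x => (a x * u x)%:E))%E).
  by rewrite EFinM lee_wpmul2l// lee_fin.
rewrite -lintZ//; last exact/lmeas_EFin/lebesgue_measurableM.
apply: (@le_trans _ _
  (lint (fun x => (a x * h (u x))%:E + t%:E * (a x)%:E)%E)).
  apply: le_lint => [||x|x].
  - apply: (@lmeas_EFin _ (fun x => s * (a x * u x))).
    by apply: lebesgue_measurableM;
      [exact: lebesgue_measurable_cst|exact: lebesgue_measurableM].
  - apply: (@lmeas_EFin _ (fun x => a x * h (u x) + t * a x)).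
    apply: lebesgue_measurableD => //.
    by apply: lebesgue_measurableM => //; exact: lebesgue_measurable_cst.
  - by rewrite mule_ge0.
  - rewrite -!EFinM -EFinD lee_fin mulrCA [t * _]mulrC -mulrDr.
    by rewrite ler_wpM2l// H.
rewrite lintD; last 4 first.
- exact: lmeas_EFin.
- apply: (@lmeas_EFin _ (fun x => t * a x)).
  by apply: lebesgue_measurableM => //; exact: lebesgue_measurable_cst.
- by [].
- by move=> x; rewrite mule_ge0// lee_fin.
rewrite leeD2l// lintZ//; last exact: lmeas_EFin.
by rewrite -[leRHS]mule1 lee_wpmul2l// lee_fin.
Qed.

Lemma jensen_zser h (a u : int -> R) m : gauge h ->
  (forall k, 0 <= a k) -> (zser (fun k => (a k)%:E) <= 1)%E ->
  (forall k, 0 <= u k) -> 0 <= m ->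
  (m%:E <= zser (fun k => (a k * u k)%:E))%E ->
  ((h m)%:E <= zser (fun k => (a k * h (u k))%:E))%E.
Proof.
move=> gh a0 a1 u0 m0 mle; have [_ h0 hs] := gh.
have [s [t [s0 t0 -> H]]] := hs m m0.
have au0 k : (0 <= (a k * u k)%:E)%E by rewrite lee_fin mulr_ge0.
have ahu0 k : (0 <= (a k * h (u k))%:E)%E by rewrite lee_fin mulr_ge0// h0.
rewrite EFinB leeBlDr//.
apply: (@le_trans _ _ (s%:E * zser (fun k => (a k * u k)%:E))%E).
  by rewrite EFinM lee_wpmul2l// lee_fin.
rewrite -zserZ//.
apply: (@le_trans _ _
  (zser (fun k => (a k * h (u k))%:E + t%:E * (a k)%:E)%E)).
  apply: le_zser => k; first by rewrite mule_ge0.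
  rewrite -!EFinM -EFinD lee_fin mulrCA [t * _]mulrC -mulrDr.
  by rewrite ler_wpM2l// H.
rewrite zserD//; last by move=> k; rewrite mule_ge0// lee_fin.
rewrite leeD2l// zserZ//.
by rewrite -[leRHS]mule1 lee_wpmul2l// lee_fin.
Qed.

End jensen.

(** * Boundedness of the Durrmeyer operators *)
Section durrmeyer.
Context {R : realType}.
Variables (phi psi : R -> R) (M Q P N : R).
Hypotheses (phi1 : L1 phi) (psi1 : L1 psi).
Hypotheses (M0 : 0 < M) (P0 : 0 < P) (Q0 : 0 < Q) (N0 : 0 < N).
Hypothesis phiM : forall u : R, (zser (fun k => `|phi (u - k%:~R)|%:E) <= M%:E)%E.
Hypothesis psiQ : forall u : R, (zser (fun k => `|psi (u - k%:~R)|%:E) <= Q%:E)%E.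
Hypothesis phiN : (lint (fun x => `|phi x|%:E) <= N%:E)%E.
Hypothesis psiP : (lint (fun x => `|psi x|%:E) <= P%:E)%E.

(** The coefficient of [phi (w x - k)] in the Durrmeyer series. *)
Definition sample (w : R) (f : R -> R) (k : int) : R :=
  w * lebesgue_int (fun u => psi (w * u - k%:~R) * f u).

(** A single term of the series bounds [psi] pointwise, so that products with
    integrable functions are integrable. *)
Lemma psi_le u : `|psi u| <= Q.
Proof.
rewrite -lee_fin; apply: le_trans (psiQ u).
have := @zser_term R (fun k => `|psi (u - k%:~R)|%:E) 0%Z.
by rewrite subr0; apply => k; rewrite lee_fin.
Qed.

Let mphi w b : 0 < w -> lebesgue_measurable (fun x => phi (w * x - b)).
Proof. by move=> w0; apply: lebesgue_measurable_aff => //; exact: L1_meas. Qed.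

Let mpsi w b : 0 < w -> lebesgue_measurable (fun x => psi (w * x - b)).
Proof. by move=> w0; apply: lebesgue_measurable_aff => //; exact: L1_meas. Qed.

Lemma sample_L1 w f b : 0 < w -> L1 f -> L1 (fun u => psi (w * u - b) * f u).
Proof.
move=> w0 f1; apply: (L1_dom _ _ (L1Z Q f1)) => [|x].
  by apply: lebesgue_measurableM; [exact: mpsi|exact: L1_meas].
by rewrite !normrM (ger0_norm (ltW Q0)) ler_wpM2r// psi_le.
Qed.

Lemma sample_le w f k : 0 < w -> L1 f -> (`|sample w f k|%:E <=
  w%:E * lint (fun u => (`|psi (w * u - k%:~R)| * `|f u|)%:E))%E.
Proof.
move=> w0 f1; rewrite /sample normrM (gtr0_norm w0) EFinM lee_pmul2l//.
apply: le_trans (lebesgue_int_le (sample_L1 k%:~R w0 f1)) _.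
by under eq_lint do rewrite normrM.
Qed.

Lemma sampleD w f g k : 0 < w -> L1 f -> L1 g ->
  sample w (fun x => f x + g x) k = sample w f k + sample w g k.
Proof.
move=> w0 f1 g1; rewrite /sample -mulrDr -lebesgue_intD; try exact: sample_L1.
by congr (_ * lebesgue_int _); apply/funext => u; rewrite mulrDr.
Qed.

Lemma zabs_phi (d : int -> R) (B u : R) : 0 <= B -> (forall k, `|d k| <= B) ->
  (zser (fun k => `|phi (u - k%:~R) * d k|%:E) <= (B * M)%:E)%E.
Proof.
move=> B0 dB.
apply: (@le_trans _ _ (zser (fun k => B%:E * `|phi (u - k%:~R)|%:E)%E)).
  apply: le_zser => k; first by rewrite lee_fin.
  by rewrite -EFinM lee_fin normrM mulrC ler_wpM2r.
rewrite zserZ//.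
by rewrite EFinM lee_wpmul2l// lee_fin.
Qed.

Lemma sample_bounded w f : 0 < w -> L1 f ->
  exists2 B, 0 <= B & forall k, `|sample w f k| <= B.
Proof.
move=> w0 f1; have := lint_fin (L1_norm f1) (fun x => normr_ge0 (f x)).
set I := lebesgue_int _ => fI; have I0 : 0 <= I.
  by rewrite -lee_fin -fI; apply: lint_ge0 => x; rewrite lee_fin.
exists (w * (Q * I)); first by rewrite !mulr_ge0 ?(ltW w0) ?(ltW Q0).
move=> k; rewrite -lee_fin (le_trans (sample_le k w0 f1))// EFinM.
rewrite lee_pmul2l// EFinM -fI -lintZ ?(ltW Q0)//; last exact/lmeas_EFin/lebesgue_measurable_norm/L1_meas.
apply: le_lint => [||x|x].
- apply: lmeas_EFin; apply: lebesgue_measurableM.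
    by apply: lebesgue_measurable_norm; exact: mpsi.
  exact/lebesgue_measurable_norm/L1_meas.
- apply: (@lmeas_EFin _ (fun x => Q * `|f x|)); apply: lebesgue_measurableM.
    exact: lebesgue_measurable_cst.
  exact/lebesgue_measurable_norm/L1_meas.
- by rewrite lee_fin mulr_ge0.
- by rewrite -EFinM lee_fin ler_wpM2r// psi_le.
Qed.

Lemma durrmeyer_zabs w f x : 0 < w -> L1 f ->
  abs_zcvg (durrmeyer_term phi psi w f x).
Proof.
move=> w0 f1; have [B B0 dB] := sample_bounded w0 f1.
by apply: le_lt_trans (zabs_phi (w * x) B0 dB) _; rewrite ltry.
Qed.

Lemma durrmeyer_definedP w f : 0 < w -> L1 f -> durrmeyer_defined phi psi w f.
Proof.
move=> w0 f1; split=> [k|x]; first exact: sample_L1.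
exact/zabs_zcvg/durrmeyer_zabs.
Qed.

Lemma durrmeyer_meas w f : 0 < w -> L1 f ->
  lebesgue_measurable (durrmeyer phi psi w f).
Proof.
move=> w0 f1; apply: (@measurable_zsum R
  (fun k (x : lebesgueT R) => durrmeyer_term phi psi w f x k)).
  move=> k; apply: (@lebesgue_measurableM R (fun x => phi (w * x - k%:~R))).
    exact: mphi.
  exact: lebesgue_measurable_cst.
by move=> x; exact/zabs_zcvg/durrmeyer_zabs.
Qed.

Lemma durrmeyerD w f g x : 0 < w -> L1 f -> L1 g ->
  durrmeyer phi psi w (fun x => f x + g x) x =
  durrmeyer phi psi w f x + durrmeyer phi psi w g x.
Proof.
move=> w0 f1 g1; rewrite /durrmeyer -zsumD; try exact/zabs_zcvg/durrmeyer_zabs.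
congr zsum; apply/funext => k; rewrite /durrmeyer_term -mulrDr; congr (_ * _).
exact: sampleD.
Qed.

Lemma durrmeyer_le w f x : (`|durrmeyer phi psi w f x|%:E <=
  zser (fun k => (`|phi (w * x - k%:~R)| * `|sample w f k|)%:E))%E.
Proof.
apply: le_trans (zsum_le _) _; rewrite (@eq_zser _ _
  (fun k => (`|phi (w * x - k%:~R)| * `|sample w f k|)%:E))// => k.
by rewrite /durrmeyer_term normrM.
Qed.

Lemma lint_psi_aff w (k : int) : 0 < w ->
  (lint (fun u => `|psi (w * u - k%:~R)|%:E) <= (w^-1 * P)%:E)%E.
Proof.
move=> w0; rewrite (@lint_aff _ w k%:~R (fun x => `|psi x|%:E))//.
  by rewrite EFinM lee_wpmul2l// lee_fin invr_ge0 ltW.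
exact/lmeas_EFin/lebesgue_measurable_norm/L1_meas.
Qed.

Lemma lint_phi_aff w (k : int) : 0 < w ->
  (lint (fun u => `|phi (w * u - k%:~R)|%:E) <= (w^-1 * N)%:E)%E.
Proof.
move=> w0; rewrite (@lint_aff _ w k%:~R (fun x => `|phi x|%:E))//.
  by rewrite EFinM lee_wpmul2l// lee_fin invr_ge0 ltW.
exact/lmeas_EFin/lebesgue_measurable_norm/L1_meas.
Qed.

(** Jensen's inequality for the weight [(w / P) |psi (w u - k)|]. *)
Lemma gauge_sample h w f k : gauge h -> 0 < w -> L1 f ->
  ((h (M * `|sample w f k|))%:E <= (w / P)%:E *
    lint (fun u => (`|psi (w * u - k%:~R)| * h (M * P * `|f u|))%:E))%E.
Proof.
move=> gh w0 f1; have [mh h0 _] := gh.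
have mpk : lebesgue_measurable (fun u => `|psi (w * u - k%:~R)|).
  by apply: lebesgue_measurable_norm; exact: mpsi.
have mMf : lebesgue_measurable (fun u => M * P * `|f u|).
  apply: lebesgue_measurableM; first exact: lebesgue_measurable_cst.
  exact/lebesgue_measurable_norm/L1_meas.
have MP0 : 0 <= M * P by rewrite mulr_ge0 ?ltW.
have wP0 : 0 <= w / P by rewrite divr_ge0 ?ltW.
rewrite -lintZ//; last 2 first.
- apply: lmeas_EFin; apply: lebesgue_measurableM => //.
  exact: lebesgue_measurable_comp.
- by move=> x; rewrite lee_fin mulr_ge0// h0// mulr_ge0.
rewrite [leRHS](@eq_lint _ _ (fun u => (w / P * `|psi (w * u - k%:~R)| *
  h (M * P * `|f u|))%:E)); last by move=> u; rewrite -EFinM mulrA.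
apply: (@jensen_lint R h (fun u => w / P * `|psi (w * u - k%:~R)|)
  (fun u => M * P * `|f u|)); first exact: gh.
- by apply: lebesgue_measurableM => //; exact: lebesgue_measurable_cst.
- by move=> x; rewrite mulr_ge0.
- under eq_lint do rewrite EFinM.
  rewrite lintZ//; last exact: lmeas_EFin.
  apply: (@le_trans _ _ ((w / P)%:E * (w^-1 * P)%:E)%E).
    by rewrite lee_wpmul2l ?lee_fin//; exact: lint_psi_aff.
  by rewrite -EFinM lee_fin (_ : w / P * _ = 1)//; field; rewrite !gt_eqF.
- by [].
- by move=> x; rewrite mulr_ge0.
- by rewrite mulr_ge0// ltW.
- have -> : (fun x => (w / P * `|psi (w * x - k%:~R)| * (M * P * `|f x|))%:E) =
      (fun x => (M * w)%:E * (`|psi (w * x - k%:~R)| * `|f x|)%:E)%E.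
    by apply/funext => x; rewrite -EFinM; congr (_%:E); field; rewrite gt_eqF.
  rewrite lintZ//; last 2 first.
  + by rewrite mulr_ge0 ?ltW.
  + apply: lmeas_EFin; apply: lebesgue_measurableM => //.
    exact/lebesgue_measurable_norm/L1_meas.
  by rewrite !EFinM -muleA lee_pmul2l//; exact: sample_le.
Qed.

(** Jensen's inequality for the weights [|phi (w x - k)| / M]. *)
Lemma gauge_durrmeyer h w f x : gauge h -> 0 < w -> L1 f ->
  ((h `|durrmeyer phi psi w f x|)%:E <= zser (fun k =>
    (M^-1 * `|phi (w * x - k%:~R)| * h (M * `|sample w f k|))%:E))%E.
Proof.
move=> gh w0 f1; have [mh h0 _] := gh.
apply: (@jensen_zser R h (fun k => M^-1 * `|phi (w * x - k%:~R)|)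
  (fun k => M * `|sample w f k|)) => //.
- by move=> k; rewrite mulr_ge0// invr_ge0 ltW.
- rewrite (@eq_zser _ _ (fun k => M^-1%:E * `|phi (w * x - k%:~R)|%:E)%E)//.
  rewrite zserZ// ?invr_ge0 ?(ltW M0)//.
  apply: (@le_trans _ _ (M^-1%:E * M%:E)%E).
    by rewrite lee_wpmul2l// lee_fin invr_ge0 ltW.
  by rewrite -EFinM mulVf// gt_eqF.
- by move=> k; rewrite mulr_ge0// ltW.
- apply: le_trans (durrmeyer_le _ _ _) _.
  rewrite [leRHS](@eq_zser _ _
    (fun k => (`|phi (w * x - k%:~R)| * `|sample w f k|)%:E))// => k.
  by congr (_%:E); field; rewrite gt_eqF.
Qed.

(** The basic estimate, uniform in [w]. The two Jensen inequalities bound the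
    integrand; integrating in [x] gives a factor [N / w] for each [k], which
    cancels the factor [w] of the samples, and the sum over [k] of
    [|psi (w u - k)|] is at most [Q]. *)
Lemma modular_durrmeyer h w f : gauge h -> 0 < w -> L1 f ->
  (lint (fun x => (h `|durrmeyer phi psi w f x|)%:E) <=
   (N * Q / (M * P))%:E * lint (fun x => (h (M * P * `|f x|))%:E))%E.
Proof.
move=> gh w0 f1; have [mh h0 _] := gh.
have MP0 : 0 <= M * P by rewrite mulr_ge0 ?ltW.
pose H u := h (M * P * `|f u|).
have H0 u : 0 <= H u by rewrite h0// mulr_ge0.
have mH : lebesgue_measurable H.
  apply: lebesgue_measurable_comp => //.
  apply: lebesgue_measurableM; first exact: lebesgue_measurable_cst.
  exact/lebesgue_measurable_norm/L1_meas.
pose c k := lint (fun u => (`|psi (w * u - k%:~R)| * H u)%:E).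
have mc k : lmeas (fun u => (`|psi (w * u - k%:~R)| * H u)%:E).
  apply: lmeas_EFin; apply: lebesgue_measurableM => //.
  by apply: lebesgue_measurable_norm; exact: mpsi.
have c0 k x : (0 <= (`|psi (w * x - k%:~R)| * H x)%:E)%E.
  by rewrite lee_fin mulr_ge0.
have hk0 k : 0 <= h (M * `|sample w f k|) by rewrite h0// mulr_ge0// ltW.
have mt k : lmeas (fun x => (M^-1 * `|phi (w * x - k%:~R)| *
    h (M * `|sample w f k|))%:E).
  apply: lmeas_EFin; apply: lebesgue_measurableM.
    apply: lebesgue_measurableM; first exact: lebesgue_measurable_cst.
    by apply: lebesgue_measurable_norm; exact: mphi.
  exact: lebesgue_measurable_cst.
have t0 k x : (0 <= (M^-1 * `|phi (w * x - k%:~R)| *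
    h (M * `|sample w f k|))%:E)%E.
  by rewrite lee_fin !mulr_ge0// invr_ge0 ltW.
apply: (@le_trans _ _ (lint (fun x => zser (fun k =>
    (M^-1 * `|phi (w * x - k%:~R)| * h (M * `|sample w f k|))%:E)))).
  apply: le_lint => [||x|x].
  - apply: lmeas_EFin; apply: lebesgue_measurable_comp => //.
    by apply: lebesgue_measurable_norm; exact: durrmeyer_meas.
  - exact: (@lmeas_zser _ (fun k x => (M^-1 * `|phi (w * x - k%:~R)| *
      h (M * `|sample w f k|))%:E)).
  - by rewrite lee_fin h0.
  - exact: gauge_durrmeyer.
rewrite (@lint_zser _ (fun k x => (M^-1 * `|phi (w * x - k%:~R)| *
  h (M * `|sample w f k|))%:E))//.
apply: (@le_trans _ _ (zser (fun k => (N / (M * P))%:E * c k)%E)).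
  apply: le_zser => [k|k]; first exact: lint_ge0.
  have -> : (fun x => (M^-1 * `|phi (w * x - k%:~R)| *
        h (M * `|sample w f k|))%:E) =
      (fun x => (M^-1 * h (M * `|sample w f k|))%:E *
        `|phi (w * x - k%:~R)|%:E)%E.
    by apply/funext => x; rewrite -EFinM; congr (_%:E); ring.
  rewrite lintZ; last 3 first.
  - by rewrite mulr_ge0// invr_ge0 ltW.
  - by apply/lmeas_EFin/lebesgue_measurable_norm; exact: mphi.
  - by move=> x; rewrite lee_fin.
  apply: (@le_trans _ _ ((M^-1 * h (M * `|sample w f k|))%:E *
      (w^-1 * N)%:E)%E).
    rewrite lee_wpmul2l ?lee_fin//; last exact: lint_phi_aff.
    by rewrite mulr_ge0// invr_ge0 ltW.
  rewrite -EFinM (_ : M^-1 * h _ * _ = (M^-1 * (w^-1 * N)) * h (M * `|sample w f k|)).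
    2: by ring.
  rewrite EFinM; apply: (@le_trans _ _
    ((M^-1 * (w^-1 * N))%:E * ((w / P)%:E * c k))%E).
    rewrite lee_wpmul2l ?lee_fin ?mulr_ge0 ?invr_ge0 ?(ltW M0) ?(ltW w0) ?(ltW N0)//.
    exact: gauge_sample.
  rewrite muleA -EFinM (_ : M^-1 * (w^-1 * N) * (w / P) = N / (M * P))//.
  by field; rewrite !gt_eqF.
rewrite zserZ; last 2 first.
- by rewrite divr_ge0// ltW.
- by move=> k; exact: lint_ge0.
rewrite (_ : N * Q / (M * P) = N / (M * P) * Q); last by rewrite mulrAC.
rewrite (EFinM (N / (M * P)) Q) -muleA lee_wpmul2l//; first by rewrite lee_fin divr_ge0// ltW.
rewrite -(@lint_zser _ (fun k u => (`|psi (w * u - k%:~R)| * H u)%:E))//.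
rewrite -lintZ ?(ltW Q0)//; last exact: lmeas_EFin.
apply: le_lint => [||x|x].
- exact: (@lmeas_zser _ (fun k u => (`|psi (w * u - k%:~R)| * H u)%:E)).
- apply: (@lmeas_EFin _ (fun x => Q * H x)); apply: lebesgue_measurableM => //.
  exact: lebesgue_measurable_cst.
- exact: zser_ge0.
- rewrite (@eq_zser _ _
    (fun k => (H x)%:E * `|psi (w * x - k%:~R)|%:E)%E); last first.
    by move=> k; rewrite mulrC.
  rewrite zserZ//.
  by rewrite muleC lee_wpmul2r ?lee_fin.
Qed.

Lemma durrmeyer_bounded w f B : 0 < w -> L1 f -> (forall x, `|f x| <= B) ->
  forall x, `|durrmeyer phi psi w f x| <= P * B * M.
Proof.
move=> w0 f1 fB x; have B0 : 0 <= B by apply: le_trans (fB 0).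
rewrite -lee_fin; apply: le_trans (zsum_le _) _.
apply: zabs_phi; first by rewrite mulr_ge0// ltW.
move=> k; rewrite -lee_fin; apply: le_trans (sample_le k w0 f1) _.
apply: (@le_trans _ _ (w%:E * (B%:E * (w^-1 * P)%:E))%E); last first.
  by rewrite -!EFinM lee_fin (_ : w * _ = P * B)//; field; rewrite gt_eqF.
rewrite lee_pmul2l//.
apply: (@le_trans _ _
  (lint (fun u => B%:E * `|psi (w * u - k%:~R)|%:E)%E)).
  apply: le_lint => [||u|u].
  - apply: lmeas_EFin; apply: lebesgue_measurableM.
      by apply: lebesgue_measurable_norm; exact: mpsi.
    exact/lebesgue_measurable_norm/L1_meas.
  - apply: (@lmeas_EFin _ (fun u => B * `|psi (w * u - k%:~R)|)).
    apply: lebesgue_measurableM; first exact: lebesgue_measurable_cst.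
    by apply: lebesgue_measurable_norm; exact: mpsi.
  - by rewrite lee_fin mulr_ge0.
  - by rewrite -EFinM lee_fin mulrC ler_wpM2r.
rewrite lintZ//; last by apply/lmeas_EFin/lebesgue_measurable_norm; exact: mpsi.
by rewrite lee_wpmul2l ?lee_fin//; exact: lint_psi_aff.
Qed.

End durrmeyer.

(** * Lattice oscillation of step functions *)
Section tame.
Context {R : realType}.
Implicit Types (f g : R -> R).

(** The integers of [(a, b]] are those from [floor a + 1] to [floor b]. *)
Lemma count_int (a b : R) : a <= b ->
  (zser (fun k : int => ((a < k%:~R) && (k%:~R <= b) : bool)%:R%:E) <= (b - a + 1)%:E)%E.
Proof.
move=> ab; pose S := [set k : int | (a < k%:~R) && (k%:~R <= b)].
rewrite -zserE; last by move=> k; rewrite lee_fin.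
have -> : (\esum_(k in [set: int]) ((a < k%:~R) && (k%:~R <= b) : bool)%:R%:E =
    \esum_(k in S) 1%:E :> \bar R)%E.
  rewrite [RHS]esum_mkcond; apply: eq_esum => k _.
  by case: ifPn => [/set_mem /= ->//|/negP nS]; case: andP => // kS;
    exfalso; apply: nS; apply/mem_set/andP.
pose m := Num.floor a; pose l := Num.floor b.
pose n := `|(l - m)%R|%N.
have ml : m <= l by rewrite floor_ge_int (le_trans (floor_le a)).
pose r := [seq m + 1 + (Posz i) | i <- iota 0 n].
have ur : uniq r.
  rewrite map_inj_uniq ?iota_uniq// => i j /addrI [] //.
have Sr : S = [set` r].
  apply/seteqP; split=> k; rewrite /S /=.
    move=> /andP[ak kb]; apply/mapP; exists `|(k - (m + 1))%R|%N.
      rewrite mem_iota add0n leq0n /=.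
      have h1 : m + 1 <= k by rewrite lezD1 floor_lt_int.
      have h2 : k <= l by rewrite floor_ge_int.
      rewrite /n; lia.
    have h1 : m + 1 <= k by rewrite lezD1 floor_lt_int.
    lia.
  move=> /mapP[i]; rewrite mem_iota add0n leq0n /= => iN ->; apply/andP; split.
    have : m < m + 1 + (Posz i) by lia.
    by rewrite floor_lt_int.
  have : m + 1 + (Posz i) <= l by rewrite /n in iN; lia.
  by rewrite floor_ge_int.
rewrite Sr esum_fset//= -fsbig_seq// sumEFin lee_fin big_const_seq count_predT.
rewrite iter_addr_0 size_map size_iota.
have -> : (1 *+ n : R) = (l - m)%:~R.
  by rewrite -[in RHS](@gez0_abs (l - m)) ?subr_ge0.
rewrite rmorphB /=.
have := floor_le b; have := floorD1_gt a; rewrite -/m -/l rmorphD /=; lra.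
Qed.

(** [1/w] times the sum is the oscillation of [f] between the lattice [Z/w] and
    its translate by [t/w], in the scale of Riemann sums. The bound
    [K min (w, |t| + 1)] makes it both bounded in [t] and, for each [t], of order
    [1/w]: exactly what dominated convergence asks for. *)
Definition tame f : Prop := exists2 K, 0 <= K & forall w t, 1 <= w ->
  (zser (fun k : int => `|f ((t + k%:~R) / w) - f (k%:~R / w)|%:E) <=
   (K * Num.min w (`|t| + 1))%:E)%E.

Lemma min_ge0 (w t : R) : 1 <= w -> 0 <= Num.min w (`|t| + 1).
Proof.
by move=> w1; rewrite le_min (le_trans ler01 w1)/= addr_ge0.
Qed.

Lemma tame_dom f g h : tame g -> tame h ->
  (forall x y, `|f x - f y| <= `|g x - g y| + `|h x - h y|) -> tame f.
Proof.
move=> [K1 K10 H1] [K2 K20 H2] fgh; exists (K1 + K2); first exact: addr_ge0.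
move=> w t w1; rewrite mulrDl EFinD.
apply: le_trans (leeD (H1 w t w1) (H2 w t w1)).
rewrite -zserD => [|k|k]; try by rewrite lee_fin.
by apply: le_zser => k; rewrite -?EFinD lee_fin.
Qed.

Lemma tame_cst c : tame (fun=> c).
Proof.
exists 0 => // w t _; rewrite mul0r [leLHS](_ : _ = 0%E)//.
by apply: eseries0 => n _ _; rewrite subrr normr0 adde0.
Qed.

Lemma tameD f g : tame f -> tame g -> tame (fun x => f x + g x).
Proof.
move=> tf tg; apply: (tame_dom tf tg) => x y.
by rewrite opprD addrACA ler_normD.
Qed.

Lemma tameZ (c : R) f : tame f -> tame (fun x => c * f x).
Proof.
move=> [K K0 H]; exists (`|c| * K); first exact: mulr_ge0.
move=> w t w1; rewrite -mulrA EFinM.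
apply: le_trans (lee_wpmul2l _ (H w t w1)); last by rewrite lee_fin.
rewrite -zserZ => [|//|k]; last by rewrite lee_fin.
by apply: le_zser => k; rewrite -?EFinM lee_fin// -mulrBr normrM.
Qed.

Lemma tame_setU (A B : set R) : tame \1_A -> tame \1_B -> tame \1_(A `|` B).
Proof.
move=> tA tB; apply: (tame_dom tA tB) => x y; rewrite !indicE !in_setU.
case: (x \in A); case: (x \in B); case: (y \in A); case: (y \in B) => /=;
  rewrite ?subrr ?subr0 ?sub0r ?normrN ?normr0 ?normr1 ?addr0 ?add0r//; lra.
Qed.

(** Translation by [t] moves [k] across the threshold [x] only if [k] lies
    between [x - t] and [x]. *)
Lemma between_le (x t k : R) :
  (((x - t < k) != (x < k)) : bool)%:R <=
  (((Num.min x (x - t) < k) && (k <= Num.max x (x - t))) : bool)%:R :> R.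
Proof.
rewrite ler_nat gt_min le_max [k <= x]leNgt [k <= x - t]leNgt.
by case: (x - t < k); case: (x < k).
Qed.

(** The bound by [w] counts the lattice points in the interval and in its
    translate; the bound by [|t| + 1] counts those that cross one of the two
    end points. *)
Lemma tame_itv (a b : R) : tame \1_(`]a, b]%classic).
Proof.
have [ba|ab] := leP b a.
  rewrite set_itv_ge ?bnd_simp -?leNgt//.
  by rewrite (_ : \1_set0 = fun=> 0);
    [exact: tame_cst|apply/funext => x; rewrite indicE in_set0].
have K0 : 0 <= 2 * (b - a + 1) by rewrite mulr_ge0// addr_ge0// subr_ge0 ltW.
exists (2 * (b - a + 1)) => // w t w1.
have w0 : 0 < w by apply: lt_le_trans w1.
have iE s k : \1_(`]a, b]%classic) ((s + k) / w) =
    ((w * a - s < k) && (k <= w * b - s))%:R :> R.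
  rewrite indicE mem_setE in_itv /= ltr_pdivlMr// ler_pdivrMr//.
  by rewrite ltrBlDl lerBrDl [a * w]mulrC [b * w]mulrC.
have cnt s : (zser (fun k : int => (\1_(`]a, b]%classic) ((s + k%:~R) / w))%:E)
    <= (w * (b - a) + 1)%:E)%E.
  under eq_zser do rewrite iE.
  apply: le_trans (count_int _) _; first by rewrite lerD2r ler_pM2l// ltW.
  by rewrite lee_fin; lra.
have btw x : (zser (fun k : int =>
    ((x - t < k%:~R) != (x < k%:~R) : bool)%:R%:E) <= (`|t| + 1)%:E)%E.
  apply: (@le_trans _ _ (zser (fun k : int => ((Num.min x (x - t) < k%:~R) &&
      (k%:~R <= Num.max x (x - t)) : bool)%:R%:E))).
    by apply: le_zser => k; rewrite lee_fin// between_le.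
  apply: le_trans (count_int _) _; first by rewrite ge_min le_max lexx.
  rewrite lee_fin lerD2r; have [t0|t0] := leP 0 t.
    by rewrite min_r ?max_l ?gerBl// opprB addrC subrK ler_norm.
  rewrite min_l ?max_r; try by rewrite lerDl oppr_ge0 ltW.
  by rewrite addrAC subrr add0r -normrN ler_norm.
(* Either both points are counted, or only the crossings of a and of b. *)
rewrite minEle; case: ifP => _.
  apply: (@le_trans _ _ (2 * (w * (b - a) + 1))%:E); last first.
    rewrite lee_fin -mulrA ler_pM2l// mulrDl mul1r lerD// mulrC//.
  rewrite mulrDl mul1r EFinD; apply: le_trans (leeD (cnt t) (cnt 0)).
  rewrite -zserD => [|k|k]; try by rewrite lee_fin.
  apply: le_zser => k; first by rewrite lee_fin.
  rewrite -EFinD lee_fin add0r (le_trans (ler_normB _ _))//.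
  by rewrite !ger0_norm.
apply: (@le_trans _ _ (2 * (`|t| + 1))%:E); last first.
  rewrite lee_fin ler_wpM2r// ?addr_ge0// ler_peMr//; lra.
rewrite mulrDl mul1r EFinD; apply: le_trans (leeD (btw (w * a)) (btw (w * b))).
rewrite -zserD => [|k|k]; try by rewrite lee_fin.
apply: le_zser => k; first by rewrite lee_fin.
rewrite -EFinD lee_fin iE -[k%:~R / w]/((k%:~R) / w).
have -> : \1_(`]a, b]%classic) (k%:~R / w) =
    ((w * a < k%:~R) && (k%:~R <= w * b))%:R :> R.
  by rewrite -[k%:~R in LHS]add0r iE !subr0.
rewrite ![_ <= _ in leLHS]leNgt.
case: (w * a - t < k%:~R); case: (w * b - t < k%:~R);
  case: (w * a < k%:~R); case: (w * b < k%:~R) => /=;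
  rewrite ?subrr ?subr0 ?sub0r ?normrN ?normr0 ?normr1 ?addr0 ?add0r//; lra.
Qed.

End tame.

(** * Density of step functions in L1 *)
Section approx.
Context {R : realType}.
Local Notation T := (lebesgueT R).
Local Notation mu := (@completed_lebesgue_measure R).
Local Notation nu := ((wlength (@idfun R))^*)%mu.
Implicit Types (f g : R -> R).

Lemma lint_triangle f g h : lebesgue_measurable f -> lebesgue_measurable g ->
  lebesgue_measurable h ->
  (lint (fun x => `|f x - h x|%:E) <=
   lint (fun x => `|f x - g x|%:E) + lint (fun x => `|g x - h x|%:E))%E.
Proof.
have lm u v : lebesgue_measurable u -> lebesgue_measurable v ->
    lmeas (fun x => `|u x - v x|%:E).
  by move=> mu_ mv; apply/lmeas_EFin/lebesgue_measurable_norm;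
    exact: lebesgue_measurableB.
move=> mf mg mh; rewrite -lintD//; try exact: lm.
apply: le_lint => [||x|x]; first exact: lm.
- apply: (@lmeas_EFin _ (fun x => `|f x - g x| + `|g x - h x|)).
  by apply: lebesgue_measurableD; apply: lebesgue_measurable_norm;
    exact: lebesgue_measurableB.
- by rewrite lee_fin.
- by rewrite -EFinD lee_fin ler_distD.
Qed.

(** Membership in the L1 closure of the tame integrable functions. *)
Definition tame_approx f : Prop := forall e : R, 0 < e -> exists g,
  [/\ tame g, L1 g & (lint (fun x => `|f x - g x|%:E) <= e%:E)%E].

Lemma tame_approx_lim f : lebesgue_measurable f ->
  (forall e : R, 0 < e -> exists g, [/\ tame_approx g, lebesgue_measurable g &
    (lint (fun x => `|f x - g x|%:E) <= e%:E)%E]) -> tame_approx f.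
Proof.
move=> mf H e e0; have e20 : 0 < e / 2 by rewrite divr_gt0.
have [g [tg mg fg]] := H _ e20; have [h [th h1 gh]] := tg _ e20.
exists h; split=> //; rewrite [e]splitr EFinD.
apply: le_trans (leeD fg gh).
by apply: lint_triangle => //; exact: L1_meas.
Qed.

Lemma tame_approxD f g : lebesgue_measurable f -> lebesgue_measurable g ->
  tame_approx f -> tame_approx g -> tame_approx (fun x => f x + g x).
Proof.
move=> mf mg tf tg e e0; have e20 : 0 < e / 2 by rewrite divr_gt0.
have [f' [tf' f'1 ff']] := tf _ e20; have [g' [tg' g'1 gg']] := tg _ e20.
exists (fun x => f' x + g' x); split; [exact: tameD|exact: L1D|].
rewrite [e]splitr EFinD; apply: le_trans (leeD ff' gg').
have mf' := L1_meas f'1; have mg' := L1_meas g'1.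
have m1 : lebesgue_measurable (fun x => `|f x - f' x|).
  by apply: lebesgue_measurable_norm; exact: lebesgue_measurableB.
have m2 : lebesgue_measurable (fun x => `|g x - g' x|).
  by apply: lebesgue_measurable_norm; exact: lebesgue_measurableB.
rewrite -lintD//; try exact: lmeas_EFin.
apply: le_lint => [||x|x].
- apply: lmeas_EFin; apply: lebesgue_measurable_norm.
  by apply: lebesgue_measurableB; exact: lebesgue_measurableD.
- exact: (lmeas_EFin (lebesgue_measurableD m1 m2)).
- by rewrite lee_fin.
- by rewrite -EFinD lee_fin opprD addrACA ler_normD.
Qed.

Lemma tame_approx0 : tame_approx (fun=> 0).
Proof.
move=> e e0; exists (fun=> 0); split.
- exact: tame_cst.
- apply/L1P; split; first exact: lebesgue_measurable_cst.
  by rewrite /lint normr0 integral0.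
- by rewrite /lint subrr normr0 integral0 lee_fin ltW.
Qed.

Lemma tame_approxZ (c : R) f : lebesgue_measurable f ->
  tame_approx f -> tame_approx (fun x => c * f x).
Proof.
move=> mf tf e e0; have e'0 : 0 < e / (`|c| + 1) by rewrite divr_gt0// ltr_wpDl.
have [g [tg g1 fg]] := tf _ e'0.
exists (fun x => c * g x); split; [exact: tameZ|exact: L1Z|].
rewrite (@eq_lint _ _ (fun x => `|c|%:E * `|f x - g x|%:E)%E); last first.
  by move=> x; rewrite -mulrBr normrM EFinM.
rewrite lintZ//; last first.
  apply: lmeas_EFin; apply: lebesgue_measurable_norm.
  by apply: lebesgue_measurableB => //; exact: L1_meas.
apply: (@le_trans _ _ (`|c|%:E * (e / (`|c| + 1))%:E)%E).
  by rewrite lee_wpmul2l ?lee_fin.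
rewrite -EFinM lee_fin mulrA ler_pdivrMr ?ltr_wpDl// mulrC ler_wpM2l ?ltW//.
by rewrite ltrDl.
Qed.

Lemma ocitv_lebesgue (A : set R) : ocitv A -> measurable (A : set T).
Proof. by move=> mA; apply: sub_caratheodory; exact: sub_sigma_algebra. Qed.

Lemma lebesgue_measurable_indic (A : set R) : measurable (A : set T) ->
  lebesgue_measurable \1_A.
Proof. by move=> mA; exact: (@measurable_indic _ T R setT A mA). Qed.

Lemma lint_indic (A : set R) : measurable (A : set T) ->
  lint (fun x => (\1_A x)%:E) = mu A.
Proof.
move=> mA; rewrite /lint.
by rewrite (@integral_indic _ T R mu setT measurableT A mA) setIT.
Qed.

Lemma L1_indic (A : set R) : measurable (A : set T) -> (mu A < +oo)%E ->
  L1 (\1_A : R -> R).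
Proof.
move=> mA Aoo; apply/L1P; split; first exact: lebesgue_measurable_indic.
rewrite (@eq_lint _ _ (fun x => (\1_A x)%:E)) ?lint_indic// => x.
by rewrite ger0_norm.
Qed.

Lemma tame_bigsetU (F : nat -> set R) n : (forall n, ocitv (F n)) ->
  tame \1_(\big[setU/set0]_(i < n) F i).
Proof.
move=> oF; elim: n => [|n IH].
  rewrite big_ord0 (_ : \1_set0 = fun=> 0); first exact: tame_cst.
  by apply/funext => x; rewrite indicE in_set0.
rewrite big_ord_recr /=; apply: tame_setU => //.
by have [[a b] _ <-] := oF n; exact: tame_itv.
Qed.

(** The outer measure is an infimum over covers by intervals. Take a cover of
    [A] whose union [U] has measure less than [mu A + e/2]; by continuity of the
    measure a finite subunion [V n] misses less than [e/2] of [U]. *)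
Lemma tame_approx_indic (A : set R) : measurable (A : set T) ->
  (mu A < +oo)%E -> tame_approx \1_A.
Proof.
move=> mA Aoo e e0; have e20 : 0 < e / 2 by rewrite divr_gt0.
have Afin : nu A \is a fin_num by rewrite ge0_fin_numE ?outer_measure_ge0.
have Afin' : mu A \is a fin_num := Afin.
have [_ [F [oF AF] <-] FA] := lb_ereal_inf_adherent e20 Afin.
have mF n := ocitv_lebesgue (oF n).
pose U := \bigcup_n F n.
have mU : measurable (U : set T) by exact: bigcupT_measurable.
have muU : (mu U < mu A + (e / 2)%:E)%E.
  apply: le_lt_trans FA.
  apply: (le_trans (outer_measure_sigma_subadditive nu F)).
  apply: lee_nneseries => [n _|n _]; first by rewrite outer_measure_ge0.
  by rewrite -((measurable_mu_extE (wlength (@idfun R))) (F n))//; exact: oF.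
have Ufin : mu U \is a fin_num.
  rewrite ge0_fin_numE ?measure_ge0// (lt_trans muU)//.
  by rewrite -(fineK Afin') -EFinD ltry.
pose V n := \big[setU/set0]_(i < n) F i.
have mV n : measurable (V n : set T).
  by apply: bigsetU_measurable => i _; exact: mF.
have VU : \bigcup_n V n = U.
  apply/seteqP; split=> x [n _]; first exact: bigsetU_bigcup.
  by move=> Fn; exists n.+1 => //; rewrite /V big_ord_recr; right.
have cV : (mu \o V) n @[n --> \oo] --> mu U.
  rewrite -VU; apply: nondecreasing_cvg_mu => //; first by rewrite VU.
  by move=> m n mn; apply/subsetPset/subset_bigsetU.
have /cV : nbhs (mu U) (fun y => mu U - (e / 2)%:E < y)%E.
  apply: open_ereal_gt'.
  by rewrite -(fineK Ufin) -EFinB lte_fin ltrBlDr ltrDl.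
case=> n _ /(_ n (leqnn n)) /= Vn.
have VnU : V n `<=` U by exact: bigsetU_bigcup.
have Vfin : mu (V n) \is a fin_num.
  rewrite ge0_fin_numE ?measure_ge0// (@le_lt_trans _ _ (mu U))//.
    by apply: le_measure => //; rewrite inE.
  by rewrite -ge0_fin_numE ?measure_ge0.
have Uoo : (mu U < +oo)%E by rewrite -ge0_fin_numE ?measure_ge0.
exists \1_(V n); split.
- exact: tame_bigsetU.
- by apply: L1_indic => //; rewrite -ge0_fin_numE ?measure_ge0.
have mUA : measurable (U `\` A : set T) by exact: measurableD.
have mUV : measurable (U `\` V n : set T) by exact: measurableD.
apply: (@le_trans _ _
    (lint (fun x => (\1_(U `\` A) x)%:E + (\1_(U `\` V n) x)%:E)%E)).
  apply: le_lint => [||x|x].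
  - apply/lmeas_EFin/lebesgue_measurable_norm.
    by apply: lebesgue_measurableB; exact: lebesgue_measurable_indic.
  - apply: (@lmeas_EFin _ (fun x => \1_(U `\` A) x + \1_(U `\` V n) x)).
    by apply: lebesgue_measurableD; exact: lebesgue_measurable_indic.
  - by rewrite lee_fin.
  - rewrite -EFinD lee_fin !indicE !in_setD.
    have [xA|xA] := boolP (x \in A).
      have -> /= : x \in U by apply/mem_set/AF/set_mem.
      by case: (x \in V n); rewrite /= ?subrr ?normr0 ?subr0 ?normr1 ?addr0 ?add0r.
    have [xV|xV] := boolP (x \in V n).
      have -> /= : x \in U by apply/mem_set/VnU/set_mem.
      by rewrite sub0r normrN normr1 addr0.
    by rewrite subrr normr0 addr_ge0.
rewrite lintD//; try by apply: lmeas_EFin; exact: lebesgue_measurable_indic.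
rewrite !lint_indic// !measureD//= !setIidr//.
rewrite -(fineK Ufin) -(fineK Vfin) -(fineK Afin') -!EFinB -EFinD lee_fin.
move: muU Vn; rewrite -(fineK Ufin) -(fineK Vfin) -(fineK Afin') -EFinD.
by rewrite -EFinB !lte_fin /=; lra.
Qed.

(** Each non-zero level set of an integrable simple function has finite
    measure. *)
Lemma tame_approx_sfun (g : {sfun T >-> R}) :
  L1 (g : T -> R) -> tame_approx (g : T -> R).
Proof.
move=> g1.
have mgr r : measurable (g @^-1` [set r] : set T).
  by apply: (measurable_funPTI g); exact: measurable_set1.
have tr r : tame_approx (fun x => r * \1_(g @^-1` [set r]) x).
  have [->|r0] := eqVneq r 0.
    rewrite (_ : (fun x => _) = (fun=> 0)); first exact: tame_approx0.
    by apply/funext => x; rewrite mul0r.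
  apply: tame_approxZ; first exact: lebesgue_measurable_indic.
  apply: tame_approx_indic => //.
  have r0' : 0 < `|r| by rewrite normr_gt0.
  rewrite -(@lte_pmul2l _ `|r|%:E)// gt0_muley ?lte_fin//.
  rewrite -lint_indic// -lintZ//; last first.
    by apply: lmeas_EFin; exact: lebesgue_measurable_indic.
  have [mg goo] := (L1P _).1 g1.
  apply: le_lt_trans goo; apply: le_lint => [||x|x].
  - apply: (@lmeas_EFin _ (fun x => `|r| * \1_(g @^-1` [set r]) x)).
    apply: lebesgue_measurableM; first exact: lebesgue_measurable_cst.
    exact: lebesgue_measurable_indic.
  - by apply: lmeas_EFin; exact: lebesgue_measurable_norm.
  - by rewrite -EFinM lee_fin mulr_ge0.
  - rewrite -EFinM lee_fin indicE.
    by case: (boolP (x \in _)) => [/set_mem /= ->|_]; rewrite ?mulr1// mulr0.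
have -> : (g : T -> R) = fun x =>
    \sum_(r <- finmap.enum_fset (fset_set (range g))) r * \1_(g @^-1` [set r]) x.
  by apply/funext => x; rewrite fimfunE fsbig_finite.
elim: (finmap.enum_fset _) => [|r s IH].
  rewrite (_ : (fun x => _) = (fun=> 0)); first exact: tame_approx0.
  by apply/funext => x; rewrite big_nil.
rewrite (_ : (fun x => _) = (fun x => r * \1_(g @^-1` [set r]) x +
  \sum_(r <- s) r * \1_(g @^-1` [set r]) x)).
  2: by apply/funext => x; rewrite big_cons.
have mr r' : lebesgue_measurable (fun x => r' * \1_(g @^-1` [set r']) x).
  apply: lebesgue_measurableM; first exact: lebesgue_measurable_cst.
  exact: lebesgue_measurable_indic.
apply: tame_approxD => //.
exact: (@measurable_sum _ T R setT R s (fun r' x => r' * \1_(g @^-1` [set r']) x)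
  mr).
Qed.

Lemma tame_approx_L1 f : L1 f -> tame_approx f.
Proof.
move=> f1; apply: tame_approx_lim; first exact: L1_meas.
move=> e e0.
have [g [g1 _ gf]] := @approximation_sfun_integrable _ T R mu setT measurableT
  (fun x => (f x)%:E) f1.
have /gf : nbhs 0%E (fun y : \bar R => y < e%:E)%E.
  by apply: open_ereal_lt'; rewrite lte_fin.
case=> n _ /(_ n (leqnn n)) /= gn; exists (g n); split.
- apply: tame_approx_sfun; exact: g1.
- apply: L1_meas; exact: g1.
- exact: ltW.
Qed.

End approx.

(** * Convergence in L1 *)
Section L1cvg.
Context {R : realType}.
Local Notation T := (lebesgueT R).
Local Notation mu := (@completed_lebesgue_measure R).

Lemma min_scale_le (s v w : R) : 0 <= s -> 0 < v -> v <= w ->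
  w^-1 * Num.min w s <= v^-1 * Num.min v s.
Proof.
move=> s0 v0 vw; have w0 : 0 < w by apply: lt_le_trans vw.
rewrite !minr_pMr ?invr_ge0 ?(ltW w0) ?(ltW v0)// !mulVf ?gt_eqF//.
by rewrite le_min !ge_min lexx/= ler_wpM2r ?orbT// lef_pV2.
Qed.

Lemma measurable_truncated_weight (kappa : R -> R) (w : R) :
  lebesgue_measurable kappa ->
  lebesgue_measurable (fun t => `|kappa t| * (w^-1 * Num.min w (`|t| + 1))).
Proof.
move=> mk; apply: lebesgue_measurableM; first exact: lebesgue_measurable_norm.
apply: lebesgue_measurableM; first exact: lebesgue_measurable_cst.
apply: (@measurable_minr _ T R setT (fun=> w) (fun t => `|t| + 1)).
  exact: lebesgue_measurable_cst.
apply: lebesgue_measurableD; last exact: lebesgue_measurable_cst.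
exact/lebesgue_measurable_norm/lebesgue_measurable_id.
Qed.

(** Dominated convergence along the integers, extended to real [w] because the
    weight decreases in [w]. *)
Lemma L1_truncation (kappa : R -> R) (e : R) : L1 kappa -> 0 < e ->
  exists2 W : R, 1 <= W & forall w, W <= w ->
  (lint (fun t => (`|kappa t| * (w^-1 * Num.min w (`|t| + 1)))%:E) <= e%:E)%E.
Proof.
move=> k1 e0; have t0 (t : R) : 0 <= `|t| + 1 by rewrite addr_ge0.
have mmin w := measurable_truncated_weight w (L1_meas k1).
pose F (n : nat) (t : R) := `|kappa t| * (n.+1%:R^-1 * Num.min n.+1%:R (`|t| + 1)).
have F0 n t : 0 <= F n t.
  by rewrite !mulr_ge0// ?invr_ge0// le_min t0 ler0n.
have K := @dominated_convergence _ T R mu setT measurableT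
  (fun n t => (F n t)%:E) (fun=> 0%E) (fun t => `|kappa t|%:E)
  (fun n => lmeas_EFin (mmin n.+1%:R)) (measurable_cst _).
have cF : (fun n => lint (fun t => (F n t)%:E)) @ \oo --> 0%E.
  have [|||_ _] := K; last by rewrite integral0.
  - apply: aeW => t _; apply: cvg_EFin; first exact: nearW.
    rewrite /= -/(F ^~ t).
    apply: (@squeeze_cvgr _ _ _ _ (fun=> 0)
      (fun n => `|kappa t| * (`|t| + 1) * n.+1%:R^-1)).
    + apply: nearW => n; rewrite F0/= -mulrA ler_wpM2l// mulrC ler_wpM2r//.
      by rewrite ge_min lexx orbT.
    + exact: cvg_cst.
    + rewrite -[X in _ --> X](mulr0 (`|kappa t| * (`|t| + 1))).
      by apply: cvgMr; exact: cvg_harmonic.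
  - exact: L1_norm.
  - apply: aeW => t n _; rewrite lee_fin ger0_norm// ler_piMr//.
    by rewrite mulrC ler_pdivrMr// mul1r ge_min lexx.
have /cF : nbhs 0%E (fun y : \bar R => y < e%:E)%E.
  by apply: open_ereal_lt'; rewrite lte_fin.
case=> n _ /(_ n (leqnn n)) /= Fn; exists n.+1%:R; first by rewrite ler1n.
move=> w nw; have w0 : 0 < w by apply: lt_le_trans nw.
apply: le_trans (ltW Fn); apply: le_lint => [||t|t].
- exact: (lmeas_EFin (mmin w)).
- exact: (lmeas_EFin (mmin n.+1%:R)).
- by rewrite lee_fin !mulr_ge0// ?invr_ge0 ?le_min ?t0 ?(ltW w0).
- by rewrite lee_fin ler_wpM2l//; exact: min_scale_le.
Qed.

Variables (phi psi : R -> R) (M Q P N : R).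
Hypotheses (phi1 : L1 phi) (psi1 : L1 psi).
Hypotheses (M0 : 0 < M) (P0 : 0 < P) (Q0 : 0 < Q) (N0 : 0 < N).
Hypothesis phiM : forall u : R, (zser (fun k => `|phi (u - k%:~R)|%:E) <= M%:E)%E.
Hypothesis psiQ : forall u : R, (zser (fun k => `|psi (u - k%:~R)|%:E) <= Q%:E)%E.
Hypothesis phiN : (lint (fun x => `|phi x|%:E) <= N%:E)%E.
Hypothesis psiP : (lint (fun x => `|psi x|%:E) <= P%:E)%E.
Implicit Types (w : R) (f kappa : R -> R).
Hypothesis phi_sum : forall u : R, zcvg (fun k => phi (u - k%:~R)) /\
  zsum (fun k => phi (u - k%:~R)) = 1.
Hypothesis psi_int : lebesgue_int psi = 1.

Let mshift (f : R -> R) (w : R) (k : int) : 0 < w -> lebesgue_measurable f ->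
  lebesgue_measurable (fun t => f ((t + k%:~R) / w)).
Proof.
move=> w0 mf; rewrite (_ : (fun t => _) = fun t => f (w^-1 * t - (- (k%:~R / w)))).
  by apply: lebesgue_measurable_aff => //; rewrite invr_gt0.
by apply/funext => t; rewrite opprK mulrDl mulrC.
Qed.

(** The error made by replacing [f] by its value at the node [k / w] in the
    window of [kappa] around that node, after the substitution [t = w x - k]. *)
Definition osc (kappa : R -> R) (w : R) (f : R -> R) (k : int) : \bar R :=
  lint (fun t => (`|kappa t| * `|f ((t + k%:~R) / w) - f (k%:~R / w)|)%:E).

Lemma osc_ge0 kappa (w : R) f k : (0 <= osc kappa w f k)%E.
Proof. by apply: lint_ge0 => t; rewrite lee_fin mulr_ge0. Qed.

Let mosc (kappa : R -> R) (w : R) (f : R -> R) (k : int) : 0 < w -> lebesgue_measurable kappa ->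
  lebesgue_measurable f -> lebesgue_measurable
    (fun t => `|kappa t| * `|f ((t + k%:~R) / w) - f (k%:~R / w)|).
Proof.
move=> w0 mk mf; apply: lebesgue_measurableM; apply: lebesgue_measurable_norm => //.
apply: lebesgue_measurableB; last exact: lebesgue_measurable_cst.
exact: mshift.
Qed.

Lemma lint_osc kappa (w : R) f (k : int) : 0 < w -> lebesgue_measurable kappa ->
  lebesgue_measurable f ->
  lint (fun x => (`|kappa (w * x - k%:~R)| * `|f x - f (k%:~R / w)|)%:E) =
  (w^-1%:E * osc kappa w f k)%E.
Proof.
move=> w0 mk mf.
rewrite -(@lint_aff _ w k%:~R (fun t =>
  (`|kappa t| * `|f ((t + k%:~R) / w) - f (k%:~R / w)|)%:E))//.
  by apply: eq_lint => x; rewrite subrK [w * x]mulrC mulfK// gt_eqF.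
exact/lmeas_EFin/mosc.
Qed.

(** The integer translates of [phi] add up to one, so [f x] can be brought under
    the sum. *)
Lemma durrmeyer_error w f x : 0 < w -> L1 f ->
  (`|durrmeyer phi psi w f x - f x|%:E <=
   zser (fun k => (`|phi (w * x - k%:~R)| * `|sample psi w f k - f x|)%:E))%E.
Proof.
move=> w0 f1; have [cphi sphi] := phi_sum (w * x).
have cS := zabs_zcvg (durrmeyer_zabs psi1 Q0 phiM psiQ x w0 f1).
rewrite [durrmeyer _ _ _ _ _ - _](_ : _ = zsum (fun k =>
    durrmeyer_term phi psi w f x k + phi (w * x - k%:~R) * (- f x))).
  apply: le_trans (zsum_le _) _.
  rewrite (@eq_zser _ _ (fun k => (`|phi (w * x - k%:~R)| *
    `|sample psi w f k - f x|)%:E))// => k.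
  by rewrite /durrmeyer_term -mulrDr normrM.
rewrite zsumD//; last exact: zcvgZ.
by rewrite zsumZ// sphi mul1r.
Qed.

(** [psi] has integral one, so [f (k / w)] can be brought under the integral. *)
Lemma sample_error w f k : 0 < w -> L1 f ->
  (`|sample psi w f k - f (k%:~R / w)|%:E <= osc psi w f k)%E.
Proof.
move=> w0 f1; set c := f _.
have pk1 := L1_aff k%:~R w0 psi1.
have pf1 := sample_L1 psi1 Q0 psiQ k%:~R w0 f1.
have I1 : L1 (fun u => psi (w * u - k%:~R) * f u - c * psi (w * u - k%:~R)).
  by apply: L1B => //; exact: L1Z.
have -> : sample psi w f k - c = w * lebesgue_int (fun u =>
    psi (w * u - k%:~R) * f u - c * psi (w * u - k%:~R)).
  rewrite lebesgue_intB//; last exact: L1Z.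
  rewrite lebesgue_intZ// (lebesgue_int_aff k%:~R w0 psi1) psi_int mulr1.
  by rewrite mulrBr /sample mulrCA mulfV ?gt_eqF// mulr1.
rewrite normrM (gtr0_norm w0) EFinM.
apply: (@le_trans _ _ (w%:E * (w^-1%:E * osc psi w f k))%E).
  rewrite lee_pmul2l// -lint_osc//; try exact: L1_meas.
  apply: le_trans (lebesgue_int_le I1) _.
  rewrite (@eq_lint _ _ (fun x =>
    (`|psi (w * x - k%:~R)| * `|f x - f (k%:~R / w)|)%:E))// => u.
  by rewrite [c * _]mulrC -mulrBr normrM.
by rewrite muleA -EFinM mulfV ?gt_eqF// mul1e.
Qed.

(** Both [f x] and the samples are compared with [f (k / w)]; the comparison with
    [f x] is weighted by [phi], the one with the samples by [psi]. *)
Lemma durrmeyer_L1_error w f : 0 < w -> L1 f ->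
  (lint (fun x => `|durrmeyer phi psi w f x - f x|%:E) <=
   w^-1%:E * zser (osc phi w f) + N%:E * (w^-1%:E * zser (osc psi w f)))%E.
Proof.
move=> w0 f1; have mf := L1_meas f1.
have mS := durrmeyer_meas phi1 psi1 Q0 phiM psiQ w0 f1.
have wi0 : 0 <= w^-1 by rewrite invr_ge0 ltW.
pose A k x := `|phi (w * x - k%:~R)| * `|f x - f (k%:~R / w)|.
pose B k x := `|phi (w * x - k%:~R)| * `|sample psi w f k - f (k%:~R / w)|.
have mphi k : lebesgue_measurable (fun x => `|phi (w * x - k%:~R)|).
  apply: lebesgue_measurable_norm; apply: lebesgue_measurable_aff => //.
  exact: L1_meas.
have mA k : lebesgue_measurable (A k).
  apply: lebesgue_measurableM; first exact: mphi.
  apply: lebesgue_measurable_norm; apply: lebesgue_measurableB => //.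
  exact: lebesgue_measurable_cst.
have mB k : lebesgue_measurable (B k).
  apply: lebesgue_measurableM; first exact: mphi.
  exact: lebesgue_measurable_cst.
have A0 k x : 0 <= A k x by rewrite mulr_ge0.
have B0 k x : 0 <= B k x by rewrite mulr_ge0.
apply: (@le_trans _ _ (lint (fun x => zser (fun k => (A k x + B k x)%:E)))).
  apply: le_lint => [||x|x].
  - by apply/lmeas_EFin/lebesgue_measurable_norm; exact: lebesgue_measurableB.
  - apply: (@lmeas_zser _ (fun k x => (A k x + B k x)%:E)) => [k|k x].
      by apply: lmeas_EFin; exact: lebesgue_measurableD.
    by rewrite lee_fin addr_ge0.
  - by rewrite lee_fin.
  - apply: le_trans (durrmeyer_error x w0 f1) _.
    apply: le_zser => k; first by rewrite lee_fin mulr_ge0.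
    rewrite lee_fin /A /B -mulrDr ler_wpM2l// [leRHS]addrC [`|f x - _|]distrC.
    exact: ler_distD.
rewrite (@lint_zser _ (fun k x => (A k x + B k x)%:E)); last 2 first.
- by move=> k; apply: lmeas_EFin; exact: lebesgue_measurableD.
- by move=> k x; rewrite lee_fin addr_ge0.
rewrite -(zserZ wi0 (osc_ge0 phi w f)) -(zserZ wi0 (osc_ge0 psi w f)).
rewrite -(zserZ (ltW N0)); last first.
  by move=> k; rewrite mule_ge0 ?osc_ge0 ?lee_fin.
rewrite -zserD; last 2 first.
- by move=> k; rewrite mule_ge0 ?osc_ge0 ?lee_fin.
- by move=> k; rewrite !mule_ge0 ?osc_ge0 ?lee_fin ?(ltW N0).
apply: le_zser => k.
  by apply: lint_ge0 => x; rewrite lee_fin addr_ge0.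
under eq_lint do rewrite EFinD.
rewrite lintD; try by [exact: lmeas_EFin|move=> x; rewrite lee_fin].
rewrite leeD//.
  by rewrite lint_osc//; exact: L1_meas.
rewrite (@eq_lint _ _ (fun x => `|sample psi w f k - f (k%:~R / w)|%:E *
  `|phi (w * x - k%:~R)|%:E)%E); last by move=> x; rewrite -EFinM mulrC.
rewrite lintZ//; last exact: lmeas_EFin.
apply: (@le_trans _ _ (osc psi w f k * (w^-1 * N)%:E)%E).
  apply: lee_pmul; rewrite ?lint_ge0//.
    exact: sample_error.
  exact: (lint_phi_aff phi1 phiN).
by rewrite muleC EFinM -muleA muleCA.
Qed.

Lemma tame_osc kappa f (e : R) : L1 kappa -> L1 f -> tame f -> 0 < e ->
  exists2 W : R, 1 <= W & forall w, W <= w ->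
    (w^-1%:E * zser (osc kappa w f) <= e%:E)%E.
Proof.
move=> k1 f1 [K K0 HK] e0.
(* The constant K may vanish, hence the division by K + 1. *)
have e'0 : 0 < e / (K + 1) by rewrite divr_gt0// ltr_wpDl.
have [W W1 HW] := L1_truncation k1 e'0.
exists W => // w Ww; have w1 := le_trans W1 Ww.
have w0 : 0 < w by apply: lt_le_trans w1.
have mk := L1_meas k1; have mf := L1_meas f1.
rewrite -(@lint_zser _ (fun k t =>
  (`|kappa t| * `|f ((t + k%:~R) / w) - f (k%:~R / w)|)%:E)); last 2 first.
- by move=> k; exact/lmeas_EFin/mosc.
- by move=> k x; rewrite lee_fin mulr_ge0.
have mz : lmeas (fun t => zser (fun k =>
    (`|kappa t| * `|f ((t + k%:~R) / w) - f (k%:~R / w)|)%:E)).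
  apply: (@lmeas_zser _ (fun k t =>
    (`|kappa t| * `|f ((t + k%:~R) / w) - f (k%:~R / w)|)%:E)) => [k|k x].
    exact/lmeas_EFin/mosc.
  by rewrite lee_fin mulr_ge0.
have z0 t : (0 <= zser (fun k =>
    (`|kappa t| * `|f ((t + k%:~R) / w) - f (k%:~R / w)|)%:E))%E.
  by apply: zser_ge0 => k; rewrite lee_fin mulr_ge0.
have wi0 : 0 <= w^-1 by rewrite invr_ge0 ltW.
have mm := measurable_truncated_weight w mk.
have mm0 t : 0 <= `|kappa t| * (w^-1 * Num.min w (`|t| + 1)).
  by rewrite !mulr_ge0// min_ge0.
rewrite -lintZ//.
apply: (@le_trans _ _ (lint (fun t => K%:E *
    (`|kappa t| * (w^-1 * Num.min w (`|t| + 1)))%:E)%E)).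
  apply: le_lint => [||t|t].
  - exact: (@measurable_funeM _ T R setT _ w^-1%:E mz).
  - apply: (@lmeas_EFin _ (fun t => K *
      (`|kappa t| * (w^-1 * Num.min w (`|t| + 1))))).
    by apply: lebesgue_measurableM => //; exact: lebesgue_measurable_cst.
  - by rewrite mule_ge0 ?lee_fin.
  - rewrite (@eq_zser _ _ (fun k => `|kappa t|%:E *
      `|f ((t + k%:~R) / w) - f (k%:~R / w)|%:E)%E)// zserZ//.
    apply: (@le_trans _ _ (w^-1%:E * (`|kappa t|%:E *
      (K * Num.min w (`|t| + 1))%:E))%E).
      by rewrite !lee_wpmul2l ?lee_fin// HK.
    by rewrite -!EFinM lee_fin le_eqVlt; apply/orP; left; apply/eqP; ring.
rewrite lintZ//; last exact: lmeas_EFin.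
apply: (@le_trans _ _ (K%:E * (e / (K + 1))%:E)%E).
  by rewrite lee_wpmul2l ?lee_fin// HW.
rewrite -EFinM lee_fin mulrA ler_pdivrMr ?ltr_wpDl// mulrC ler_wpM2l ?(ltW e0)//.
by rewrite lerDl.
Qed.

Lemma durrmeyer_tame_cvg f (e : R) : L1 f -> tame f -> 0 < e ->
  exists2 W : R, 0 < W & forall w, W <= w ->
    (lint (fun x => `|durrmeyer phi psi w f x - f x|%:E) <= e%:E)%E.
Proof.
move=> f1 tf e0; have e20 : 0 < e / 2 by rewrite divr_gt0.
have eN : 0 < e / 2 / N by rewrite divr_gt0.
have [W1 W11 H1] := tame_osc phi1 f1 tf e20.
have [W2 W21 H2] := tame_osc psi1 f1 tf eN.
exists (Num.max W1 W2); first by rewrite lt_max (lt_le_trans _ W11).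
move=> w; rewrite ge_max => /andP[w1 w2].
have w0 : 0 < w by apply: lt_le_trans w1; apply: lt_le_trans W11.
apply: le_trans (durrmeyer_L1_error w0 f1) _.
rewrite [e in leRHS]splitr EFinD leeD//; first exact: H1.
apply: (@le_trans _ _ (N%:E * (e / 2 / N)%:E)%E).
  by rewrite lee_pmul2l// H2.
by rewrite -EFinM lee_fin mulrCA mulfV ?gt_eqF// mulr1.
Qed.

Lemma durrmeyer_L1_le w f : 0 < w -> L1 f ->
  (lint (fun x => `|durrmeyer phi psi w f x|%:E) <=
   (N * Q)%:E * lint (fun x => `|f x|%:E))%E.
Proof.
move=> w0 f1; have MP0 : 0 < M * P by rewrite mulr_gt0.
have := modular_durrmeyer phi1 psi1 M0 P0 Q0 N0 phiM psiQ phiN psiP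
  gauge_id w0 f1.
move=> /le_trans; apply => /=.
rewrite (@eq_lint _ _ (fun x => (M * P)%:E * `|f x|%:E)%E); last first.
  by move=> x; rewrite EFinM.
rewrite lintZ ?(ltW MP0)//; last first.
  exact/lmeas_EFin/lebesgue_measurable_norm/L1_meas.
by rewrite muleA -EFinM divfK// gt_eqF.
Qed.

(** The operators are bounded on L1 uniformly in [w], which is
    [modular_durrmeyer] for the identity, so convergence on the dense tame
    functions extends to all of L1. *)
Lemma durrmeyer_L1_cvg f (e : R) : L1 f -> 0 < e ->
  exists2 W : R, 0 < W & forall w, W <= w ->
    (lint (fun x => `|durrmeyer phi psi w f x - f x|%:E) <= e%:E)%E.
Proof.
move=> f1 e0; have e20 : 0 < e / 2 by rewrite divr_gt0.
have C0 : 0 < N * Q + 1 by rewrite ltr_wpDl// mulr_ge0 ?ltW.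
have d0 : 0 < e / 2 / (N * Q + 1) by rewrite divr_gt0.
have [g [tg g1 fg]] := tame_approx_L1 f1 d0.
have [W W0 HW] := durrmeyer_tame_cvg g1 tg e20.
exists W => // w Ww; have w0 : 0 < w by apply: lt_le_trans Ww.
have r1 := L1B f1 g1; have gE : f = fun x => g x + (f x - g x).
  by apply/funext => x; rewrite addrC subrK.
have mSf := durrmeyer_meas phi1 psi1 Q0 phiM psiQ w0 f1.
have mSg := durrmeyer_meas phi1 psi1 Q0 phiM psiQ w0 g1.
have mSr := durrmeyer_meas phi1 psi1 Q0 phiM psiQ w0 r1.
have mf := L1_meas f1; have mg := L1_meas g1; have mr := L1_meas r1.
have SfE x : durrmeyer phi psi w f x =
    durrmeyer phi psi w g x + durrmeyer phi psi w (fun x => f x - g x) x.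
  by rewrite {1}gE (durrmeyerD psi1 Q0 phiM psiQ x w0 g1 r1).
have m1 : lebesgue_measurable (fun x => `|durrmeyer phi psi w g x - g x|).
  exact: (lebesgue_measurable_norm (lebesgue_measurableB mSg mg)).
have m2 : lebesgue_measurable
    (fun x => `|durrmeyer phi psi w (fun x => f x - g x) x|).
  exact: (lebesgue_measurable_norm mSr).
have m3 : lebesgue_measurable (fun x => `|f x - g x|).
  exact: (lebesgue_measurable_norm mr).
apply: (@le_trans _ _ (lint (fun x => `|durrmeyer phi psi w g x - g x|%:E +
    (`|durrmeyer phi psi w (fun x => f x - g x) x|%:E + `|f x - g x|%:E))%E)).
  apply: le_lint => [||x|x].
  - exact: (lmeas_EFin (lebesgue_measurable_norm (lebesgue_measurableB mSf mf))).
  - exact: (lmeas_EFin (lebesgue_measurableD m1 (lebesgue_measurableD m2 m3))).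
  - by rewrite lee_fin.
  - rewrite -!EFinD lee_fin SfE; set a := durrmeyer _ _ _ g x.
    set b := durrmeyer _ _ _ _ x.
    rewrite (_ : a + b - f x = (a - g x) + (b - (f x - g x))); last by ring.
    by rewrite (le_trans (ler_normD _ _))// lerD2l ler_normB.
rewrite lintD; last 4 first.
- exact: lmeas_EFin.
- exact: (lmeas_EFin (lebesgue_measurableD m2 m3)).
- by move=> x; rewrite lee_fin.
- by move=> x; rewrite -EFinD lee_fin addr_ge0.
rewrite [e in leRHS]splitr EFinD leeD//; first exact: HW.
rewrite lintD; try by [exact: lmeas_EFin|move=> x; rewrite lee_fin].
apply: (@le_trans _ _ ((N * Q + 1)%:E * lint (fun x => `|f x - g x|%:E))%E).
  rewrite EFinD ge0_muleDl ?lee_fin ?mulr_ge0 ?(ltW N0) ?(ltW Q0)// mul1e.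
  by rewrite leeD2r//; exact: durrmeyer_L1_le.
apply: (@le_trans _ _ ((N * Q + 1)%:E * (e / 2 / (N * Q + 1))%:E)%E).
  by rewrite lee_pmul2l.
by rewrite -EFinM lee_fin mulrCA mulfV ?gt_eqF// mulr1.
Qed.

End L1cvg.

(** * Finiteness of the discrete moments *)
Section moments.
Context {R : realType}.
Implicit Types (g : R -> R).

Lemma L1_bound g : L1 g ->
  exists2 B : R, 0 < B & (lint (fun x => `|g x|%:E) <= B%:E)%E.
Proof.
move=> g1; rewrite (lint_fin (L1_norm g1) (fun x => normr_ge0 (g x))).
set I := lebesgue_int _; exists (`|I| + 1); first by rewrite ltr_wpDl.
by rewrite lee_fin (le_trans (ler_norm I))// lerDl.
Qed.

Lemma Mabs_le nu g (u : R) :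
  (zser (fun k => (`|g (u - k%:~R)| * `|u - k%:~R| `^ nu)%:E) <= Mabs nu g)%E.
Proof.
rewrite -zserE => [|k]; last by rewrite lee_fin mulr_ge0// powR_ge0.
by apply: ereal_sup_ubound; exists u.
Qed.

Lemma Mabs_fin nu g : (Mabs nu g < +oo)%E -> exists2 B : R, 0 < B &
  forall u, (zser (fun k => (`|g (u - k%:~R)| * `|u - k%:~R| `^ nu)%:E) <=
    B%:E)%E.
Proof.
move=> goo; have M0 : (0 <= Mabs nu g)%E.
  apply: le_trans (Mabs_le nu g 0); apply: zser_ge0 => k.
  by rewrite lee_fin mulr_ge0// powR_ge0.
have Mfin : Mabs nu g \is a fin_num by rewrite ge0_fin_numE.
exists (fine (Mabs nu g) + 1); first by rewrite ltr_wpDl// fine_ge0.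
move=> u; apply: le_trans (Mabs_le nu g u) _.
by rewrite -[leLHS](fineK Mfin) lee_fin lerDl.
Qed.

Lemma Mabs0_bound g : (Mabs 0 g < +oo)%E -> exists2 B : R, 0 < B &
  forall u, (zser (fun k => `|g (u - k%:~R)|%:E) <= B%:E)%E.
Proof.
move=> /Mabs_fin[B B0 HB]; exists B => // u; apply: le_trans (HB u).
by apply: le_zser => k; rewrite lee_fin// powRr0 mulr1.
Qed.

(** Terms with [|u - k| >= d] are controlled by the moment of order [r], at the
    price of [1 / d^r]; those with [|u - k| < d] are bounded, and their number is
    at most [2 d + 1]. *)
Lemma Mabs_bounded_near g (r : R) : 0 < r -> (Mabs r g < +oo)%E ->
  bounded_near g (nbhs (0 : R)) -> exists2 B : R, 0 < B &
  forall u, (zser (fun k => `|g (u - k%:~R)|%:E) <= B%:E)%E.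
Proof.
move=> r0 /Mabs_fin[A A0 HA] /ex_bound[C /nbhs_ballP[d /= d0 HC]].
have {}HC x : `|x| < d -> `|g x| <= `|C|.
  move=> xd; apply: le_trans (ler_norm C); apply: HC.
  by rewrite /ball /= sub0r normrN.
have dr0 : 0 < d `^ r by rewrite powR_gt0.
exists (A / d `^ r + `|C| * (2 * d + 1)).
  by rewrite ltr_wpDr ?divr_gt0// mulr_ge0// addr_ge0// mulr_ge0// ltW.
move=> u.
pose J (k : int) : R := ((u - d < k%:~R) && (k%:~R <= u + d))%:R.
apply: (@le_trans _ _ (zser (fun k =>
    (d `^ r)^-1%:E * (`|g (u - k%:~R)| * `|u - k%:~R| `^ r)%:E +
    `|C|%:E * (J k)%:E)%E)).
  apply: le_zser => k; first by rewrite lee_fin.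
  rewrite -!EFinM -EFinD lee_fin; have [ud|du] := ltP `|u - k%:~R| d.
    rewrite -[leLHS]add0r lerD//.
      by rewrite !mulr_ge0 ?powR_ge0// invr_ge0 ltW.
    rewrite /J; move: (ud); rewrite ltr_norml => /andP[h1 h2].
    have -> : u - d < k%:~R by rewrite ltrBlDl -ltrBlDr.
    have -> : k%:~R <= u + d by rewrite -lerBlDl -[leLHS]opprB lerNl ltW.
    by rewrite mulr1; exact: HC.
  rewrite -[leLHS]addr0 lerD ?mulr_ge0//.
  rewrite mulrCA ler_peMr// mulrC ler_pdivlMr// mul1r.
  by rewrite ge0_ler_powR// ?nnegrE ?(ltW d0)// ltW.
rewrite zserD; last 2 first.
- by move=> k; rewrite mule_ge0 ?lee_fin ?invr_ge0 ?mulr_ge0 ?powR_ge0 ?(ltW dr0).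
- by move=> k; rewrite mule_ge0 ?lee_fin.
rewrite EFinD leeD//.
  rewrite zserZ ?invr_ge0 ?(ltW dr0)//.
  by rewrite mulrC EFinM lee_wpmul2l// lee_fin invr_ge0 ltW.
rewrite zserZ//; last by move=> k; rewrite lee_fin.
rewrite EFinM lee_wpmul2l ?lee_fin//.
apply: le_trans (count_int _) _; first by lra.
by rewrite lee_fin; lra.
Qed.

End moments.

(** * Scaling and truncation in L log L *)
Section LlogL.
Context {R : realType}.
Local Notation T := (lebesgueT R).
Local Notation mu := (@completed_lebesgue_measure R).
Implicit Types (f g : R -> R).

Lemma measurable_eta_norm (c : R) g : lebesgue_measurable g ->
  lebesgue_measurable (fun x => eta11 (c * `|g x|)).
Proof.
move=> mg; apply: (lebesgue_measurable_comp (@eta11_measurable R)).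
apply: lebesgue_measurableM; first exact: lebesgue_measurable_cst.
exact: lebesgue_measurable_norm.
Qed.

(** By the Delta_2 condition the finiteness of the modular at one scale gives it
    at all scales. *)
Lemma LlogL_scale f (c : R) : LlogL f -> 0 <= c ->
  (lint (fun x => (eta11 (c * `|f x|))%:E) < +oo)%E.
Proof.
move=> [mf [l l0]]; rewrite /modular11 lebesgue_eintE => foo c0.
have cl0 : 0 <= c / l by rewrite divr_ge0// ltW.
have [K K0 HK] := eta11_scale cl0.
have mlf : lebesgue_measurable (fun x => eta11 `|l * f x|).
  rewrite (_ : (fun x => _) = fun x => eta11 (l * `|f x|)).
    exact: measurable_eta_norm.
  by apply/funext => x; rewrite normrM gtr0_norm.
apply: (@le_lt_trans _ _ (lint (fun x => K%:E * (eta11 `|l * f x|)%:E)%E)).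
  apply: le_lint => [||x|x].
  - exact/lmeas_EFin/measurable_eta_norm.
  - apply: (@lmeas_EFin _ (fun x => K * eta11 `|l * f x|)).
    by apply: lebesgue_measurableM => //; exact: lebesgue_measurable_cst.
  - by rewrite lee_fin eta11_ge0// mulr_ge0.
  - rewrite -EFinM lee_fin normrM (gtr0_norm l0).
    rewrite (_ : c * `|f x| = c / l * (l * `|f x|)).
      by apply: HK; rewrite mulr_ge0// ltW.
    by field; rewrite gt_eqF.
rewrite lintZ ?(ltW K0)//; last 2 first.
- exact: lmeas_EFin.
- by move=> x; rewrite lee_fin eta11_ge0.
by apply: lte_mul_pinfty => //; rewrite lee_fin ltW.
Qed.

Lemma LlogL_L1 f : LlogL f -> L1 f.
Proof.
move=> hf; have mf := hf.1; apply/L1P; split=> //.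
apply: le_lt_trans (LlogL_scale hf ler01); apply: le_lint => [||x|x].
- exact/lmeas_EFin/lebesgue_measurable_norm.
- exact/lmeas_EFin/measurable_eta_norm.
- by rewrite lee_fin.
- by rewrite lee_fin mul1r eta11_ge.
Qed.

(** Written as a product with an indicator so that measurability is
    immediate. *)
Definition trunc (n : nat) f : R -> R :=
  fun x => f x * \1_(`[- n%:R, n%:R]%classic) (f x).

Lemma truncE n f x : trunc n f x = if `|f x| <= n%:R then f x else 0.
Proof.
rewrite /trunc indicE mem_setE in_itv /= -ler_norml.
by case: ifP => _; rewrite ?mulr1 ?mulr0.
Qed.

Lemma measurable_trunc n f : lebesgue_measurable f ->
  lebesgue_measurable (trunc n f).
Proof.
move=> mf; apply: lebesgue_measurableM => //.
apply: (@lebesgue_measurable_comp R (\1_(`[- n%:R, n%:R]%classic))) => //.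
Qed.

Lemma trunc_le n f x : `|trunc n f x| <= n%:R.
Proof. by rewrite truncE; case: ifP => // _; rewrite normr0. Qed.

Lemma L1_trunc n f : L1 f -> L1 (trunc n f).
Proof.
move=> f1; apply: (L1_dom (measurable_trunc n (L1_meas f1)) _ f1) => x.
by rewrite truncE; case: ifP => // _; rewrite normr0.
Qed.

Lemma eta11_0 : eta11 (0 : R) = 0.
Proof. by rewrite /eta11 mul0r. Qed.

Lemma LlogL_tail f (c e : R) : LlogL f -> 0 <= c -> 0 < e -> exists n,
  (lint (fun x => (eta11 (c * `|f x - trunc n f x|))%:E) <= e%:E)%E.
Proof.
move=> hf c0 e0; have mf := hf.1.
pose F n x := eta11 (c * `|f x - trunc n f x|).
have mF n : lebesgue_measurable (F n).
  apply: measurable_eta_norm; apply: lebesgue_measurableB => //.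
  exact: measurable_trunc.
have F0 n x : 0 <= F n x by rewrite eta11_ge0// mulr_ge0.
have K := @dominated_convergence _ T R mu setT measurableT
  (fun n t => (F n t)%:E) (fun=> 0%E) (fun x => (eta11 (c * `|f x|))%:E)
  (fun n => lmeas_EFin (mF n)) (measurable_cst _).
have cF : (fun n => lint (fun t => (F n t)%:E)) @ \oo --> 0%E.
  have [|||_ _] := K; last by rewrite integral0.
  - apply: aeW => x _; apply: cvg_near_cst.
    exists (Num.truncn `|f x|).+1 => // n /= fn; rewrite /F truncE ifT.
      by rewrite subrr normr0 mulr0 eta11_0.
    rewrite (le_trans (ltW (truncnS_gt _)))// ler_nat//.
  - apply/integrableP; split; first exact/lmeas_EFin/measurable_eta_norm.
    have := LlogL_scale hf c0; rewrite /lint; apply: le_lt_trans.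
    rewrite le_eqVlt; apply/orP; left; apply/eqP; apply: eq_integral => x _.
    by rewrite gee0_abs// lee_fin eta11_ge0// mulr_ge0.
  - apply: aeW => x n _; rewrite lee_fin ger0_norm//.
    apply: (gauge_le (@gauge_eta11 R)); rewrite ?mulr_ge0// ler_wpM2l//.
    by rewrite truncE; case: ifP => _; rewrite ?subr0// subrr normr0.
have /cF : nbhs 0%E (fun y : \bar R => y < e%:E)%E.
  by apply: open_ereal_lt'; rewrite lte_fin.
by case=> n _ /(_ n (leqnn n)) /= Fn; exists n; exact: ltW.
Qed.

Lemma cvg_pinfty_ereal0 (F : R -> \bar R) :
  (\forall w \near +oo%R, 0 <= F w)%E ->
  (forall e : R, 0 < e ->
    exists2 W : R, 0 < W & forall w, W <= w -> (F w <= e%:E)%E) ->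
  F w @[w --> +oo%R] --> 0%E.
Proof.
move=> F0 HF A [d /= d0 dA].
have [W W0 HW] := HF (d / 2) (divr_gt0 d0 (ltr0n _ 2)).
suff : \forall w \near +oo%R, A (F w) by [].
near=> w.
have w0 : (0 <= F w)%E by near: w.
have wW : (F w <= (d / 2)%:E)%E.
  by apply: HW; near: w; apply: nbhs_pinfty_ge; exact: num_real.
have wfin : F w \is a fin_num by rewrite ge0_fin_numE// (le_lt_trans wW)// ltry.
move: w0 wW; rewrite -(fineK wfin) !lee_fin => w0 wW.
apply: dA; rewrite /ball /= sub0r normrN ger0_norm// (le_lt_trans wW)//.
by rewrite ltr_pdivrMr// ltr_pMr// ltr1n.
Unshelve. all: by end_near. Qed.

End LlogL.

(** * Convergence in L log L *)
Section final.
Context {R : realType}.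
Variables (phi psi : R -> R) (M Q P N : R).
Hypotheses (phi1 : L1 phi) (psi1 : L1 psi).
Hypotheses (M0 : 0 < M) (P0 : 0 < P) (Q0 : 0 < Q) (N0 : 0 < N).
Implicit Types (w : R) (f : R -> R).
Hypothesis phiM : forall u : R, (zser (fun k => `|phi (u - k%:~R)|%:E) <= M%:E)%E.
Hypothesis psiQ : forall u : R, (zser (fun k => `|psi (u - k%:~R)|%:E) <= Q%:E)%E.
Hypothesis phiN : (lint (fun x => `|phi x|%:E) <= N%:E)%E.
Hypothesis psiP : (lint (fun x => `|psi x|%:E) <= P%:E)%E.
Hypothesis phi_sum : forall u : R, zcvg (fun k => phi (u - k%:~R)) /\
  zsum (fun k => phi (u - k%:~R)) = 1.
Hypothesis psi_int : lebesgue_int psi = 1.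

Let S w f x := durrmeyer phi psi w f x.

Let mS w f : 0 < w -> L1 f -> lebesgue_measurable (S w f).
Proof. exact: (durrmeyer_meas phi1 psi1 Q0 phiM psiQ). Qed.

Let MP0 : 0 < M * P. Proof. exact: mulr_gt0. Qed.
Let C0 : 0 < N * Q / (M * P).
Proof. by apply: divr_gt0; apply: mulr_gt0. Qed.

Lemma eta_durrmeyer (c : R) w f : 0 <= c -> 0 < w -> L1 f ->
  (lint (fun x => (eta11 (c * `|S w f x|))%:E) <=
   (N * Q / (M * P))%:E *
     lint (fun x => (eta11 (c * (M * P * `|f x|)))%:E))%E.
Proof.
move=> c0 w0 f1.
exact: (modular_durrmeyer phi1 psi1 M0 P0 Q0 N0 phiM psiQ phiN psiP
  (gauge_scale c0 (@gauge_eta11 R)) w0 f1).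
Qed.

Let eta_monotone (a b : R) : 0 <= a -> a <= b -> eta11 a <= eta11 b.
Proof. exact: (gauge_le (@gauge_eta11 R)). Qed.

Lemma durrmeyer_LlogL w f : 0 < w -> LlogL f -> LlogL (fun x => S w f x - f x).
Proof.
move=> w0 hf; have f1 := LlogL_L1 hf; have mf := L1_meas f1; have msf := mS w0 f1.
have md : lebesgue_measurable (fun x => S w f x - f x).
  exact: (lebesgue_measurableB msf mf).
split=> //; exists 1 => //; rewrite /modular11 lebesgue_eintE.
have m1 : lebesgue_measurable (fun x => eta11 (3 * `|S w f x|)).
  exact: measurable_eta_norm.
have m2 : lebesgue_measurable (fun x => eta11 (3 * `|f x|)).
  exact: measurable_eta_norm.
apply: (@le_lt_trans _ _ (lint (fun x => (eta11 (3 * `|S w f x|))%:E) +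
    lint (fun x => (eta11 (3 * `|f x|))%:E))%E).
  rewrite -lintD; last 4 first.
  - exact: (lmeas_EFin m1).
  - exact: (lmeas_EFin m2).
  - by move=> x; rewrite lee_fin eta11_ge0// mulr_ge0.
  - by move=> x; rewrite lee_fin eta11_ge0// mulr_ge0.
  apply: le_lint => [||x|x].
  - apply: lmeas_EFin.
    rewrite (_ : (fun x => _) = fun x => eta11 (1 * `|S w f x - f x|)).
      exact: (measurable_eta_norm 1 md).
    by apply/funext => x; rewrite !mul1r.
  - exact: (lmeas_EFin (lebesgue_measurableD m1 m2)).
  - by rewrite lee_fin eta11_ge0.
  - rewrite -EFinD lee_fin mul1r.
    apply: (@le_trans _ _ (eta11 (`|S w f x| + `|f x| + 0))).
      by apply: eta_monotone => //; rewrite addr0 ler_normB.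
    apply: le_trans (gauge_add3 (@gauge_eta11 R) _ _ _) _ => //.
    by rewrite mulr0 eta11_0 addr0.
rewrite lte_add_pinfty//; last exact: LlogL_scale.
apply: le_lt_trans (eta_durrmeyer _ w0 f1) _ => //.
apply: lte_mul_pinfty => //; first by rewrite lee_fin ltW.
have := LlogL_scale hf (mulr_ge0 (ler0n _ 3) (ltW MP0)).
by under eq_lint do rewrite -mulrA.
Qed.

(** With [g] the truncation of [f] at height [n] and [r = f - g], the error is
    [(S g - g) + S r - r]. On [S g - g], which is bounded by [K] for all [w],
    the function [u ln (e + u)] is dominated by a linear one, so convergence in
    L1 suffices; the other two terms are small with the modular of [r]. *)
Lemma durrmeyer_eta_cvg (l e : R) f : 0 < l -> 0 < e -> LlogL f ->
  exists2 W : R, 0 < W & forall w, W <= w ->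
    (lint (fun x => (eta11 (l * `|S w f x - f x|))%:E) <= e%:E)%E.
Proof.
move=> l0 e0 hf; have f1 := LlogL_L1 hf; have mf := L1_meas f1.
pose C := N * Q / (M * P); have C1 : 0 < C + 1 by rewrite ltr_wpDl// ltW.
pose c := 3 * l; have c0 : 0 < c by rewrite mulr_gt0.
(* One scale that dominates both c * M * P, for S r, and c, for r. *)
pose c' := c * (M * P + 1).
have MP1 : 0 < M * P + 1 by rewrite ltr_wpDl// ltW.
have c'0 : 0 <= c' by rewrite mulr_ge0// ltW.
have e20 : 0 < e / 2 by rewrite divr_gt0.
have d0 : 0 < e / 2 / (C + 1) by rewrite divr_gt0.
have [n Hn] := LlogL_tail hf c'0 d0.
pose g := trunc n f; pose r x := f x - g x.
have g1 : L1 g by exact: L1_trunc.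
have r1 : L1 r by exact: L1B.
have mg := L1_meas g1; have mr := L1_meas r1.
(* A bound for the truncated error, uniform in w and x. *)
pose K := P * n%:R * M + n%:R.
have K0 : 0 <= K by rewrite addr_ge0// !mulr_ge0// ltW.
have cK0 : 0 <= c * K by rewrite mulr_ge0// ltW.
pose D := c * ln (expR 1 + c * K).
have D0 : 0 < D by rewrite mulr_gt0// (lt_le_trans _ (ln_ge1 cK0)).
have [W W0 HW] := durrmeyer_L1_cvg phi1 psi1 M0 P0 Q0 N0 phiM psiQ phiN psiP
  phi_sum psi_int g1 (divr_gt0 e20 D0).
exists W => // w Ww; have w0 : 0 < w by apply: lt_le_trans Ww.
have mSg := mS w0 g1; have mSr := mS w0 r1; have mSf := mS w0 f1.
have SfE x : S w f x = S w g x + S w r x.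
  have fE : (fun x => g x + r x) = f.
    by apply/funext => y; rewrite /r addrC subrK.
  by rewrite /S -(durrmeyerD psi1 Q0 phiM psiQ x w0 g1 r1) fE.
have md := lebesgue_measurableB mSg mg.
have m1 := lebesgue_measurableM (@lebesgue_measurable_cst R D)
  (lebesgue_measurable_norm md).
have m2 := measurable_eta_norm c mSr.
have m3 := measurable_eta_norm c mr.
have p2 x : (0 <= (eta11 (c * `|S w r x|))%:E)%E.
  by rewrite lee_fin eta11_ge0// mulr_ge0// ltW.
have p3 x : (0 <= (eta11 (c * `|r x|))%:E)%E.
  by rewrite lee_fin eta11_ge0// mulr_ge0// ltW.
apply: (@le_trans _ _ (lint (fun x => (D * `|S w g x - g x|)%:E +
    ((eta11 (c * `|S w r x|))%:E + (eta11 (c * `|r x|))%:E))%E)).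
  apply: le_lint => [||x|x].
  - exact: (lmeas_EFin (measurable_eta_norm l (lebesgue_measurableB mSf mf))).
  - exact: (lmeas_EFin (lebesgue_measurableD m1 (lebesgue_measurableD m2 m3))).
  - by rewrite lee_fin eta11_ge0// mulr_ge0// ltW.
  - rewrite -!EFinD lee_fin.
    have a0 : 0 <= l * `|S w g x - g x| by rewrite mulr_ge0// ltW.
    have b0 : 0 <= l * `|S w r x| by rewrite mulr_ge0// ltW.
    have r0 : 0 <= l * `|r x| by rewrite mulr_ge0// ltW.
    apply: (@le_trans _ _ (eta11 (l * `|S w g x - g x| + l * `|S w r x| +
        l * `|r x|))).
      apply: eta_monotone; first by rewrite mulr_ge0// ltW.
      have fE : f x = g x + r x by rewrite /r addrC subrK.
      have E (a b u v : R) : a + b - (u + v) = a - u + b - v by ring.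
      rewrite -!mulrDr ler_wpM2l ?(ltW l0)// SfE fE E.
      by rewrite (le_trans (ler_normB _ _))// lerD2r ler_normD.
    apply: le_trans (gauge_add3 (@gauge_eta11 R) a0 b0 r0) _.
    rewrite !mulrA -/c -addrA lerD2r.
    rewrite (_ : D * _ = c * `|S w g x - g x| * ln (expR 1 + c * K)).
      2: by rewrite /D mulrAC.
    rewrite /eta11 ler_wpM2l//.
      by rewrite mulr_ge0// ltW.
    apply: le_ln_e; first by rewrite mulr_ge0// ltW.
    rewrite ler_wpM2l ?(ltW c0)// (le_trans (ler_normB _ _))// lerD ?trunc_le//.
    apply: (durrmeyer_bounded psi1 P0 Q0 phiM psiQ psiP w0 g1).
    by move=> y; exact: trunc_le.
rewrite lintD; last 4 first.
- exact: (lmeas_EFin m1).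
- exact: (lmeas_EFin (lebesgue_measurableD m2 m3)).
- by move=> x; rewrite lee_fin mulr_ge0// ltW.
- by move=> x; rewrite adde_ge0.
rewrite [e]splitr EFinD leeD//.
  under eq_lint do rewrite EFinM.
  rewrite (lintZ (ltW D0)); last 2 first.
  - exact: (lmeas_EFin (lebesgue_measurable_norm md)).
  - by move=> x; rewrite lee_fin.
  apply: (@le_trans _ _ (D%:E * (e / 2 / D)%:E)%E).
    by rewrite lee_pmul2l//; exact: HW.
  by rewrite -EFinM lee_fin mulrCA mulfV ?gt_eqF// mulr1.
rewrite (lintD (lmeas_EFin m2) (lmeas_EFin m3) p2 p3).
have m4 := measurable_eta_norm c' mr.
pose I := lint (fun x => (eta11 (c' * `|r x|))%:E).
have I0 : (0 <= I)%E.
  by apply: lint_ge0 => x; rewrite lee_fin eta11_ge0// mulr_ge0.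
apply: (@le_trans _ _ ((C + 1)%:E * I)%E); last first.
  apply: (@le_trans _ _ ((C + 1)%:E * (e / 2 / (C + 1))%:E)%E).
    by rewrite lee_pmul2l.
  by rewrite -EFinM lee_fin mulrCA mulfV ?gt_eqF// mulr1.
rewrite EFinD ge0_muleDl ?lee_fin ?(ltW C0)// mul1e leeD//.
  apply: le_trans (eta_durrmeyer (ltW c0) w0 r1) _.
  rewrite lee_wpmul2l// ?lee_fin ?(ltW C0)//; apply: le_lint => [||x|x].
  - rewrite (_ : (fun x => _) = fun x => (eta11 (c * (M * P) * `|r x|))%:E).
      exact: (lmeas_EFin (measurable_eta_norm _ mr)).
    by apply/funext => x; rewrite mulrA.
  - exact: (lmeas_EFin m4).
  - by rewrite lee_fin eta11_ge0// !mulr_ge0// ltW.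
  - rewrite lee_fin; apply: eta_monotone.
      by rewrite !mulr_ge0// ltW.
    by rewrite mulrA ler_wpM2r// ler_wpM2l ?(ltW c0)// lerDl.
apply: le_lint => [||x|x].
- exact: (lmeas_EFin m3).
- exact: (lmeas_EFin m4).
- exact: p3.
- rewrite lee_fin; apply: eta_monotone; first by rewrite mulr_ge0// ltW.
  by rewrite ler_wpM2r// ler_peMr ?(ltW c0)// lerDr ltW.
Qed.

End final.

Theorem corollary6p4 (R : realType) (phi psi : R -> R)
    (hker : kernel_pair phi psi) (hpsi : (Mabs 0 psi < +oo)%E)
    (f : R -> R) (hf : LlogL f) :
  [/\ (forall w : R, 0 < w ->
        durrmeyer_defined phi psi w f /\
        LlogL (fun x => durrmeyer phi psi w f x - f x)),
      (forall lambda : R, 0 < lambda ->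
        lebesgue_eint (fun x =>
          `|durrmeyer phi psi w f x - f x| *
            ln (expR 1 + lambda * `|durrmeyer phi psi w f x - f x|))
          @[w --> +oo%R] --> 0%E)
    & LlogL_norm (fun x => durrmeyer phi psi w f x - f x)
        @[w --> +oo%R] --> 0%E].
Proof.
have [[phi1 psi1] bphi phi_sum psi_int [r r0 Mr]] := hker.
have [M M0 phiM] := Mabs_bounded_near r0 Mr bphi.
have [Q Q0 psiQ] := Mabs0_bound hpsi.
have [N N0 phiN] := L1_bound phi1.
have [P P0 psiP] := L1_bound psi1.
have f1 := LlogL_L1 hf.
have LL w : 0 < w -> LlogL (fun x => durrmeyer phi psi w f x - f x).
  by move=> w0; exact: (durrmeyer_LlogL phi1 psi1 M0 P0 Q0 N0 phiM psiQ phiN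
    psiP w0 hf).
have C := fun l e l0 e0 => @durrmeyer_eta_cvg R phi psi M Q P N phi1 psi1 M0 P0
  Q0 N0 phiM psiQ phiN psiP phi_sum psi_int l e f l0 e0 hf.
split.
- move=> w w0; split; last exact: LL.
  exact: (durrmeyer_definedP psi1 Q0 phiM psiQ w0 f1).
- move=> l l0; apply: cvg_pinfty_ereal0.
    apply: nearW => w; apply: lint_ge0 => x.
    by rewrite lee_fin mulr_ge0// (le_trans ler01)// ln_ge1// mulr_ge0// ltW.
  move=> e e0; have [W W0 HW] := C l (l * e) l0 (mulr_gt0 l0 e0).
  exists W; [exact: W0|move=> w Ww]; have w0 : 0 < w by apply: lt_le_trans Ww.
  rewrite -(@lee_pmul2l _ l%:E)// -EFinM.
  apply: le_trans (HW w Ww); rewrite lebesgue_eintE -lintZ ?(ltW l0)//.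
  + by under eq_lint do rewrite -EFinM mulrA.
  + rewrite (_ : (fun x => _) = fun x => (l^-1 *
        eta11 (l * `|durrmeyer phi psi w f x - f x|))%:E).
      apply: lmeas_EFin; apply: lebesgue_measurableM.
        exact: lebesgue_measurable_cst.
      exact: (measurable_eta_norm l (LL w w0).1).
    by apply/funext => x; rewrite /eta11 !mulrA mulVf ?mul1r// gt_eqF.
  + by move=> x; rewrite lee_fin mulr_ge0// (le_trans ler01)// ln_ge1// mulr_ge0// ltW.
- apply: cvg_pinfty_ereal0.
    apply: nearW => w; apply/le_ereal_inf_tmp => _ [l [l0 _] <-].
    by rewrite lee_fin ltW.
  move=> e e0; have ei0 : 0 < e^-1 by rewrite invr_gt0.
  have [W W0 HW] := C e^-1 1 ei0 ltr01.
  exists W; [exact: W0|move=> w Ww]; apply: ereal_inf_lbound; exists e => //; split => //.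
  rewrite /modular11 lebesgue_eintE; apply: le_trans (HW w Ww).
  rewrite le_eqVlt; apply/orP; left; apply/eqP; apply: eq_lint => x.
  by rewrite normrM [`|e^-1|]gtr0_norm// mulrC.
Qed.
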